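(* Consider the stability conditions near the large complex structure limit $x=0$ on the heart $\mathrm{mod}\,A_3^{\otimes5}$ with central charges $Z'_x$, whose stable objects are the simple representations $s$. Let $S(x)$ be the sum of the distinct central charges $Z'_x(s)$ of stable objects (i.e. of the distinct functions among the $x\mapsto Z'_x(s)$). Then, by dilation and rotation with the quintic period $w(x,0)$, this sum is the mirror map: $$\frac{S(x)}{w(x,0)}=t(x)=\frac{\Pi_B(x)[2]}{\Pi_B(x)[1]}.$$
   Context: $A_3^{\otimes5}$ is the quiver with vertices $s=\{s_1,\dots,s_5\}$, $0\le s_i\le3$, an arrow $s\to s'$ whenever $s'$ is obtained from $s$ by raising one $s_i$ by $1$, and all squares commuting; $\mathrm{mod}\,A_3^{\otimes5}$ is its category of finite-dimensional complex representations, a heart of $D^b(\mathrm{mod}\,A_3^{\otimes5})\cong D^b_G(\mathrm{Coh}\,X)$ ($X$ the Fermat quintic threefold, $G\cong\mathbb Z_5^5/\mathbb Z_5$ acting diagonally by fifth roots of unity). The simple representation at vertex $s$ is also written $s$. Let $w(x,p)=\sum_{n\ge0}\frac{\Gamma(1+5(n+p))}{\Gamma(1+(n+p))^5}x^{n+p}$, $w_k(x)=\partial_p^kw(x,p)|_{p=0}$, and $\Pi_B={}^t(w^{(0)},w^{(1)},w^{(2)},w^{(3)})$ with $w^{(0)}=w(x,0)$, $w^{(1)}=\frac{w_1}{2\pi i}$, $w^{(2)}=\frac{5w_2}{2!(2\pi i)^2}+\frac{11}2\frac{w_1}{2\pi i}$, $w^{(3)}=-\frac{5w_3}{3!(2\pi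 i)^3}-\frac{50}{12}\frac{w_1}{2\pi i}$. Components of a vector are denoted $[1],\dots,[4]$. Let $$M_\infty=\begin{pmatrix}1&0&0&-1\\-1&1&0&1\\-3&-5&1&3\\5&-8&1&-4\end{pmatrix}.$$ The central charge $Z'_x$ is the homomorphism on the Grothendieck group determined on simple representations by $$Z'_x(s)=\big(M_\infty^{\sum s_i}\Pi_B(x)\big)[4]+\frac{\Pi_B(x)[2]}5 .$$ Dilation and rotation means multiplying all central charges by a common nonzero complex number (here $1/w(x,0)$). *)

(* Defs.v *)
From HB Require Import structures.
From mathcomp Require Import all_boot all_order all_algebra.
From mathcomp Require Import complex.
From mathcomp Require Import all_classical all_reals all_analysis.
Set Implicit Arguments.
Unset Strict Implicit.
Unset Printing Implicit Defensive.
Import Order.TTheory GRing.Theory Num.Theory.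
Import numFieldNormedType.Exports.
Local Open Scope classical_set_scope.
Local Open Scope complex_scope.
Local Open Scope ring_scope.

(* The complex numbers R[i] with the topology given by their norm. *)
HB.instance Definition _ (R : rcfType) := NormedModule.copy R[i] R[i]^o.

Section Representations.
Variable F : fieldType.

Definition vertex := {ffun 'I_5 -> 'I_4}.

Definition arrow (s t : vertex) : bool :=
  [exists i, (t i == (s i).+1 :> nat) && [forall (j | j != i), t j == s j]].

(* The space at [s] is 'rV_(dim s), on which matrices act on the right.  For
   [a = b] the condition [rep_square] holds trivially. *)
Record rep := Rep {
  dim : vertex -> nat;
  rep_map : forall s t, arrow s t -> 'M[F]_(dim s, dim t);
  rep_square : forall s a b t (sa : arrow s a) (at_ : arrow a t)
      (sb : arrow s b) (bt : arrow b t),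
    rep_map sa *m rep_map at_ = rep_map sb *m rep_map bt }.

Record hom (V W : rep) := Hom {
  hom_mx :> forall s, 'M[F]_(dim V s, dim W s);
  hom_comm : forall s t (st : arrow s t),
    rep_map V st *m hom_mx t = hom_mx s *m rep_map W st }.

Definition iso (V W : rep) : Prop :=
  exists (f : hom V W) (g : hom W V),
    forall s, f s *m g s = 1%:M /\ g s *m f s = 1%:M.

Definition is_zero (V : rep) : Prop := forall s, dim V s = 0%N.

Definition short_exact (U V W : rep) (f : hom U V) (g : hom V W) : Prop :=
  forall s, [/\ row_free (f s), (f s == kermx (g s))%MS & row_full (g s)].

Definition is_direct_sum (U W V : rep) : Prop :=
  exists (f : hom U V) (g : hom V W) (h : hom W V),
    short_exact f g /\ forall s, h s *m g s = 1%:M.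

Lemma simple_square (v s a b t : vertex) (sa : arrow s a) (at_ : arrow a t)
    (sb : arrow s b) (bt : arrow b t) :
  (0 : 'M[F]_((s == v : nat), (a == v : nat)))
     *m (0 : 'M[F]_((a == v : nat), (t == v : nat)))
  = (0 : 'M[F]_((s == v : nat), (b == v : nat)))
     *m (0 : 'M[F]_((b == v : nat), (t == v : nat))).
Proof. by rewrite !mul0mx. Qed.

Definition simple_rep (v : vertex) : rep :=
  @Rep (fun s => (s == v : nat)) (fun _ _ _ => 0) (simple_square v).

Lemma short_exact_dim (U V W : rep) (f : hom U V) (g : hom V W) :
  short_exact f g -> forall s, dim V s = (dim U s + dim W s)%N.
Proof.
move=> fg s; have [/eqP rf /eqmxP fk /eqP rg] := fg s.
by rewrite -[dim U s]rf fk mxrank_ker rg subnK // -rg rank_leq_row.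
Qed.

End Representations.

Arguments rep_map {F} V {s t} _ : rename.

Section Complex.
Variable R : realType.
Local Notation C := R[i].

Definition expC (z : C) : C :=
  (expR (complex.Re z) * cos (complex.Im z))
    +i* (expR (complex.Re z) * sin (complex.Im z)).

(* Euler's integral of t^(z-1) e^(-t), meaningful for 0 < Re z.  Below it is
   only used near the integers 1 + 5n and 1 + n. *)
Definition gamma_integrand (z : C) (t : R) : C :=
  expC ((z - 1) * (ln t)%:C - t%:C).

Definition Gamma (z : C) : C :=
  (\int[lebesgue_measure]_(t in `]0%R, +oo[) complex.Re (gamma_integrand z t))
  +i*
  (\int[lebesgue_measure]_(t in `]0%R, +oo[) complex.Im (gamma_integrand z t)).

End Complex.

Section Stability.
Variable R : realType.
Local Notation C := R[i].
Local Notation rep := (rep C).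

(* [HN P E phi]: there is a filtration 0 = E_0 < E_1 < ... < E_n = E, n > 0,
   whose successive quotients are nonzero objects of P phi_1, ..., P phi_n with
   phi_1 > ... > phi_n = phi. *)
Inductive HN (P : R -> rep -> Prop) : rep -> R -> Prop :=
| HN_semistable E phi : ~ is_zero E -> P phi E -> HN P E phi
| HN_extend E' E A phi' phi (f : hom E' E) (g : hom E A) :
    HN P E' phi' -> phi < phi' -> short_exact f g ->
    ~ is_zero A -> P phi A -> HN P E phi.

(* [Z] is the central charge and [P phi] the subcategory of semistable objects
   of phase [phi].  As for a slicing of a triangulated category, phases are
   arbitrary real numbers: the objects of the heart need not have their phases
   in one interval of length 1. *)
Record stability_condition (Z : rep -> C) (P : R -> rep -> Prop) : Prop := {
  slice_iso : forall phi E E', iso E E' -> P phi E -> P phi E';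
  slice_zero : forall phi E, is_zero E -> P phi E;
  slice_sum : forall phi E1 E2 E,
    is_direct_sum E1 E2 E -> P phi E1 -> P phi E2 -> P phi E;
  slice_phase : forall phi E, P phi E -> ~ is_zero E ->
    exists2 m : R, 0 < m & Z E = m%:C * expC (0 +i* (pi * phi));
  slice_hom : forall phi1 phi2 E1 E2 (f : hom E1 E2),
    P phi1 E1 -> P phi2 E2 -> phi2 < phi1 -> forall s, f s = 0;
  slice_HN : forall E, ~ is_zero E -> exists phi, HN P E phi }.

Definition stable (P : R -> rep -> Prop) (E : rep) : Prop :=
  exists phi, [/\ ~ is_zero E, P phi E &
    forall A B (f : hom A E) (g : hom E B), short_exact f g ->
      P phi A -> P phi B -> is_zero A \/ is_zero B].

End Stability.

Section Periods.
Variable R : realType.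
Local Notation C := R[i].
Local Notation rep := (rep C).
(* [lg] is the branch of the logarithm used to define the powers of x. *)
Variable lg : C -> C.

Definition w (x p : C) : C :=
  limn (series (fun n =>
    Gamma (1 + 5 * (n%:R + p)) / Gamma (1 + (n%:R + p)) ^+ 5
      * expC ((n%:R + p) * lg x))).

Definition w_ (k : nat) (x : C) : C := derive1n k (w x) 0.

Definition twopii : C := 2 * pi%:C * 'i.

Definition PiB (x : C) : 'cV[C]_4 :=
  \col_i nth 0 [:: w x 0;
    w_ 1 x / twopii;
    5 * w_ 2 x / (2`!%:R * twopii ^+ 2) + 11 / 2 * (w_ 1 x / twopii);
    - (5 * w_ 3 x / (3`!%:R * twopii ^+ 3)) - 50 / 12 * (w_ 1 x / twopii)] i.

(* Components are numbered from 1. *)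
Definition component (v : 'cV[C]_4) (k : nat) : C := v (inord k.-1) 0.

Definition M_infty : 'M[C]_4 :=
  \matrix_(i, j) (nth 0 (nth [::]
    [:: [::  1;  0; 0; -1];
        [:: -1;  1; 0;  1];
        [:: -3; -5; 1;  3];
        [::  5; -8; 1; -4]] i) j : int)%:~R.

Definition Z_simple (x : C) (s : vertex) : C :=
  component (M_infty ^+ (\sum_i s i)%N *m PiB x) 4 + component (PiB x) 2 / 5.

(* The class of a representation in the Grothendieck group is the sum of the
   classes of the simple ones, weighted by its dimension vector. *)
Definition Z' (x : C) (V : rep) : C := \sum_s Z_simple x s *+ dim V s.

Lemma Z'_simple_rep (x : C) (s : vertex) : Z' x (simple_rep C s) = Z_simple x s.
Proof.
rewrite /Z' (bigD1 s) //= eqxx mulr1n big1 ?addr0 // => t /negbTE ->.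
exact: mulr0n.
Qed.

Lemma Z'_short_exact (x : C) (U V W : rep) (f : hom U V) (g : hom V W) :
  short_exact f g -> Z' x V = Z' x U + Z' x W.
Proof.
move=> fg; rewrite /Z' -big_split; apply: eq_bigr => s _ /=.
by rewrite (short_exact_dim fg) mulrnDr.
Qed.

(* The central charges of the objects that are stable all over [U], as functions
   on [U]; extending them by 0 identifies two of them exactly when they agree
   on [U]. *)
Definition stable_charges (U : set C) (P : C -> R -> rep -> Prop) :
    set (C -> C) :=
  [set patch (fun=> 0) U (fun x => Z' x E)
    | E in [set E | forall x, U x -> stable (P x) E]].

Definition charge_sum (U : set C) (P : C -> R -> rep -> Prop) (x : C) : C :=
  \sum_(f \in stable_charges U P) f x.

Definition mirror_map (x : C) : C := component (PiB x) 2 / component (PiB x) 1.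

End Periods.

(* Main.v *)
(** The last row of [M_infty ^+ k] depends only on [k] modulo 5 and takes five
    values, whose sum is zero; so if the five charges are distinct functions
    their sum is [5 * PiB[2] / 5 = PiB[2]], and [PiB[1] = w(x,0)].

    Distinctness needs the asymptotics of the periods at [x = 0]. The recursion
    of Gamma gives [w(x,p) = x^p g(x,p)], where [g = sum_n a_n(p) x^n] and
    [a_(n+1)/a_n] is a product of factors [5 - c/(n+1+p)]. A calculus of functions
    with uniformly controlled difference quotients (stable under products,
    inverses, summable series and integrals) shows that [g] is three times
    differentiable in [p], with bounds uniform in [x]. Hence by Leibniz [w_k] is
    [log x ^ k g(x,0)] plus lower powers of [log x] with bounded coefficients,
    and [g(x,0)] stays away from 0. The difference of two charges is a
    polynomial of degree 2 or 3 in [log x] with dominant leading coefficient,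
    nonzero as [|log x|] tends to infinity, whatever the branch of the logarithm. *)
Require Import Defs.
From mathcomp Require Import all_boot all_order all_algebra.
From mathcomp Require Import complex.
From mathcomp Require Import all_classical all_reals all_analysis.
From mathcomp Require Import measurable_realfun ring lra.
Set Implicit Arguments.
Unset Strict Implicit.
Unset Printing Implicit Defensive.
Import Order.TTheory GRing.Theory Num.Theory.
Import numFieldNormedType.Exports.
Local Open Scope classical_set_scope.
Local Open Scope complex_scope.
Local Open Scope ring_scope.

(** [w_] is an iterated [derive1n] of a [limn], and both have arbitrary values where the limits do
    not exist, so convergence and differentiability must be established before any period can be
    computed. The bound h(p+q) - h(p) - q h'(p) = O(q^2), with an explicit constant, plays the part
    of holomorphy: it can be summed over n and integrated over t.

    [Gamma] is Euler's integral, under control only for positive real part. The ball of p is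
    therefore so small that 5p stays in the disc of radius 1/4 where Gamma(1 + p) is smooth. All
    later coefficients follow from the recursion at the cost of one constant factor per step, which
    gives a positive radius of convergence in x without Stirling's formula.

    Equal functions count once in the sum, which is why distinctness matters. It concerns functions
    on [U], so one point of [U] per pair of charges suffices, taken close to 0, which lies in the
    closure of [U]. Every branch is covered because Re log x = ln |x|, hence |log x| >= - ln |x|. *)

Section ComplexModulus.
Variable R : realType.
Local Notation C := R[i].
Implicit Types (x y z : C).

(** The norm of [R[i]] is itself a complex number; estimates are carried out in the totally ordered
    field [R] instead. *)
Definition cabs (z : C) : R := complex.Re `|z|.

Lemma normCE z : `|z| = (cabs z)%:C.
Proof. by rewrite /cabs normc_def. Qed.

Lemma cabsE z : cabs z = Num.sqrt (complex.Re z ^+ 2 + complex.Im z ^+ 2).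
Proof. by rewrite /cabs normc_def. Qed.

Lemma cabs_ge0 z : 0 <= cabs z.
Proof. by rewrite cabsE sqrtr_ge0. Qed.

Lemma cabsM x y : cabs (x * y) = cabs x * cabs y.
Proof. by apply: complexI; rewrite rmorphM /= -!normCE normrM. Qed.

Lemma cabsD x y : cabs (x + y) <= cabs x + cabs y.
Proof. by rewrite -lecR rmorphD/= -!normCE ler_normD. Qed.

Lemma cabsN x : cabs (- x) = cabs x.
Proof. by rewrite /cabs normrN. Qed.

Lemma cabsB x y : cabs (x - y) <= cabs x + cabs y.
Proof. by rewrite -(cabsN y) cabsD. Qed.

Lemma cabs0 : cabs 0 = 0.
Proof. by rewrite /cabs normr0. Qed.

Lemma cabs1 : cabs 1 = 1.
Proof. by rewrite /cabs normr1. Qed.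

Lemma cabs_eq0 x : (cabs x == 0) = (x == 0).
Proof.
rewrite -(normr_eq0 x) /cabs; apply/eqP/eqP => [h|->//].
by have := normCE x; rewrite /cabs h => ->.
Qed.

Lemma cabs_gt0 x : (0 < cabs x) = (x != 0).
Proof. by rewrite lt0r cabs_ge0 andbT cabs_eq0. Qed.

Lemma cabsV x : cabs x^-1 = (cabs x)^-1.
Proof.
have [->|x0] := eqVneq x 0; first by rewrite invr0 cabs0 invr0.
apply: (mulfI (_ : cabs x != 0)); first by rewrite cabs_eq0.
by rewrite -cabsM divff// divff ?cabs1// cabs_eq0.
Qed.

Lemma cabsX x n : cabs (x ^+ n) = cabs x ^+ n.
Proof. by elim: n => [|n IH]; rewrite ?expr0 ?cabs1// !exprS cabsM IH. Qed.

Lemma cabsR (a : R) : cabs a%:C = `|a|.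
Proof. by rewrite cabsE/= expr0n addr0 sqrtr_sqr. Qed.

Lemma cabs_nat n : cabs n%:R = n%:R.
Proof.
have -> : n%:R = (n%:R : R)%:C by rewrite rmorph_nat.
by rewrite cabsR normr_nat.
Qed.

Lemma ler_Re_cabs z : `|complex.Re z| <= cabs z.
Proof. by rewrite cabsE -sqrtr_sqr ler_wsqrtr// lerDl sqr_ge0. Qed.

Lemma ler_Im_cabs z : `|complex.Im z| <= cabs z.
Proof. by rewrite cabsE -sqrtr_sqr ler_wsqrtr// lerDr sqr_ge0. Qed.

Lemma cabs_le_ReIm z : cabs z <= `|complex.Re z| + `|complex.Im z|.
Proof.
rewrite cabsE -[leRHS]ger0_norm ?addr_ge0// -sqrtr_sqr ler_wsqrtr//.
rewrite sqrrD !real_normK ?num_real//.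
by rewrite -addrA lerD2l lerDr mulrn_wge0// mulr_ge0.
Qed.

Lemma cabs_lower x y : cabs x - cabs y <= cabs (x + y).
Proof. by rewrite lerBlDr -{1}(addrK y x) cabsB. Qed.

End ComplexModulus.

(** * Functions with uniformly controlled remainders *)

Section Smooth.
Variable R : realType.
Local Notation C := R[i].
Implicit Types (r B : R) (p q : C) (f g h : C -> C).

Definition qdiff r B h h' := forall p q, cabs p < r -> cabs (p + q) < r ->
  cabs (h (p + q) - h p - q * h' p) <= B * cabs q ^+ 2.

Definition bounded_by r B h := forall p, cabs p < r -> cabs (h p) <= B.

(* [h] has a chain of [k] successive derivatives on the ball of radius [r], all
   bounded by [B], with quadratic remainders also controlled by [B]: unlike plain
   differentiability, this passes to limits. *)
Fixpoint smooth r (k : nat) B h : Prop :=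
  bounded_by r B h /\
  if k is k'.+1 then exists2 h', qdiff r B h h' & smooth r k' B h' else True.

Lemma smooth_bounded r k B h : smooth r k B h -> bounded_by r B h.
Proof. by case: k => [|k] []. Qed.

Lemma smoothW r k B B' h : B <= B' -> smooth r k B h -> smooth r k B' h.
Proof.
move=> BB'; have bW f : bounded_by r B f -> bounded_by r B' f.
  by move=> fB p /fB /le_trans; apply.
elim: k h => [|k IH] h /= [hB]; first by split=> //; apply: bW.
move=> [h' hh' h'B]; split; first exact: bW.
exists h'; last exact: IH.
move=> p q pr qr; apply: le_trans (hh' p q pr qr) _.
by rewrite ler_wpM2r// exprn_ge0// cabs_ge0.
Qed.

Lemma smooth_pred r k B h : smooth r k.+1 B h -> smooth r k B h.
Proof.
elim: k h => [|k IH] h; first by case=> hB _; split.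
move=> [hB [h' hh' h'B]]; split=> //.
by exists h' => //; apply: IH.
Qed.

Lemma smooth_ext r k B f g : (forall p, cabs p < r -> f p = g p) ->
  smooth r k B f -> smooth r k B g.
Proof.
move=> fg; have bE : bounded_by r B f -> bounded_by r B g.
  by move=> fB p pr; rewrite -fg//; apply: fB.
case: k => [|k] /= [/bE fB]; first by split.
move=> [f' ff' f'B]; split=> //; exists f' => //.
by move=> p q pr qr; rewrite -!fg//; apply: ff'.
Qed.

Lemma smooth_cst r k (c : C) : smooth r k (cabs c) (fun=> c).
Proof.
have cst0 (B : R) n : 0 <= B -> smooth r n B (fun=> 0).
  move=> B0; elim: n => [|n IH] /=; first by split=> // p _; rewrite cabs0.
  split; first by move=> p _; rewrite cabs0.
  exists (fun=> 0) => // p q _ _; rewrite mulr0 !subr0 cabs0.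
  by rewrite mulr_ge0// exprn_ge0// cabs_ge0.
case: k => [|k] /=; first by split=> // p _.
split; first by move=> p _.
exists (fun=> 0); last exact/cst0/cabs_ge0.
move=> p q _ _; rewrite mulr0 subr0 subrr cabs0.
by rewrite mulr_ge0 ?exprn_ge0// cabs_ge0.
Qed.

Lemma smooth_affine r k (a b : C) : r <= 1 ->
  smooth r k (cabs a + cabs b) (fun p => a + b * p).
Proof.
move=> r1; have bd : bounded_by r (cabs a + cabs b) (fun p => a + b * p).
  move=> p pr; apply: le_trans (cabsD _ _) _; rewrite lerD2l cabsM.
  by rewrite ler_piMr ?cabs_ge0// (le_trans (ltW pr)).
case: k => [|k] /=; first by split.
split=> //; exists (fun=> b); last first.
  by apply: smoothW (smooth_cst _ _ _); rewrite lerDr cabs_ge0.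
move=> p q _ _; rewrite (_ : _ - _ = 0); last by ring.
by rewrite cabs0 mulr_ge0 ?exprn_ge0 ?addr_ge0// cabs_ge0.
Qed.

Lemma smoothD r k A B f g : smooth r k A f -> smooth r k B g ->
  smooth r k (A + B) (fun p => f p + g p).
Proof.
elim: k f g => [|k IH] f g /= [fA f1] [gB g1].
  split=> // p pr; apply: le_trans (cabsD _ _) _.
  by apply: lerD; [exact: fA|exact: gB].
split.
  move=> p pr; apply: le_trans (cabsD _ _) _.
  by apply: lerD; [exact: fA|exact: gB].
move: f1 g1 => [f' ff' f'A] [g' gg' g'B].
exists (fun p => f' p + g' p); last exact: IH.
move=> p q pr qr.
rewrite (_ : _ - _ = (f (p + q) - f p - q * f' p) + (g (p + q) - g p - q * g' p));
  last by ring.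
apply: le_trans (cabsD _ _) _; rewrite mulrDl.
by apply: lerD; [exact: ff'|exact: gg'].
Qed.

(** Two points of a ball of radius at most 1 are at distance at most 2, so the quadratic remainder
    is at most 2B|q|; the term q f'(p) adds B|q|. *)
Lemma qdiff_lip r B f f' : r <= 1 -> bounded_by r B f' -> qdiff r B f f' ->
  forall p q, cabs p < r -> cabs (p + q) < r ->
  cabs (f (p + q) - f p) <= 3 * B * cabs q.
Proof.
move=> r1 f'B ff' p q pr qr.
have q2 : cabs q <= 2.
  have -> : q = (p + q) - p by ring.
  apply: le_trans (cabsB _ _) _; lra.
have B0 : 0 <= B by apply: le_trans (f'B p pr); exact: cabs_ge0.
have -> : f (p + q) - f p = (f (p + q) - f p - q * f' p) + q * f' p by ring.
apply: le_trans (cabsD _ _) _; rewrite cabsM.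
have := ff' p q pr qr; have := f'B p pr; have := cabs_ge0 q.
move: (cabs q) q2 => a a2; move: (cabs (f' p)) => b.
move: (cabs (_ - _)) => c a0 bB cB.
have : a ^+ 2 <= 2 * a by nra.
nra.
Qed.

(** The constant 5 is 1 + 1 + 3: the remainder of g times f, the remainder of f times g, and q g'
    times the increment of f, which [qdiff_lip] bounds with the factor 3. *)
Lemma qdiffM r A B f f' g g' : r <= 1 ->
  bounded_by r A f -> bounded_by r A f' -> qdiff r A f f' ->
  bounded_by r B g -> bounded_by r B g' -> qdiff r B g g' ->
  qdiff r (5 * (A * B)) (fun p => f p * g p) (fun p => f' p * g p + f p * g' p).
Proof.
move=> r1 fA f'A ff' gB g'B gg' p q pr qr.
rewrite (_ : _ - _ = f (p + q) * (g (p + q) - g p - q * g' p)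
   + g p * (f (p + q) - f p - q * f' p) + q * g' p * (f (p + q) - f p)); last by ring.
apply: le_trans (cabsD _ _) _.
apply: le_trans (lerD (cabsD _ _) (lexx _)) _; rewrite !cabsM.
have := qdiff_lip r1 f'A ff' pr qr; have := ff' p q pr qr.
have := gg' p q pr qr; have := g'B p pr; have := fA _ qr; have := gB p pr.
have := cabs_ge0 (f (p + q)); have := cabs_ge0 (g p); have := cabs_ge0 (g' p).
have := cabs_ge0 q.
have := cabs_ge0 (f (p + q) - f p).
have := cabs_ge0 (f (p + q) - f p - q * f' p).
have := cabs_ge0 (g (p + q) - g p - q * g' p).
move: (cabs q) => a; move: (cabs (g (p + q) - _ - _)) => gq.
move: (cabs (f (p + q) - _ - _)) => fq; move: (cabs (f (p + q) - _)) => fl.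
move: (cabs (g' p)) => g1; move: (cabs (g p)) => g0; move: (cabs (f (p + q))) => f0.
move=> h1 h2 h3 h4 h5 h6 h7 h8 h9 h10 h11 h12 h13.
have A0 : 0 <= A by lra.
have B0 : 0 <= B by lra.
have e1 : f0 * gq <= A * (B * a ^+ 2) by exact: ler_pM.
have e2 : g0 * fq <= B * (A * a ^+ 2) by exact: ler_pM.
have e3 : a * g1 * fl <= a * B * (3 * A * a).
  by apply: ler_pM => //; [exact: mulr_ge0|exact: ler_wpM2l].
by move: e1 e2 e3; rewrite !expr2; lra.
Qed.

(* Products cost a factor 2^k * 5, which is harmless: it only enters geometric
   rates. *)
Lemma smoothM r k A B f g : r <= 1 -> smooth r k A f -> smooth r k B g ->
  smooth r k (2 ^+ k * 5 * (A * B)) (fun p => f p * g p).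
Proof.
move=> r1.
have bM n A' B' f1 g1 : bounded_by r A' f1 -> bounded_by r B' g1 ->
    bounded_by r (2 ^+ n * 5 * (A' * B')) (fun p => f1 p * g1 p).
  move=> fA gB p pr; have := fA p pr; have := gB p pr; rewrite cabsM.
  have := cabs_ge0 (f1 p); have := cabs_ge0 (g1 p).
  move: (cabs (f1 p)) (cabs (g1 p)) => a b b0 a0 bB aA.
  have k1 : 1 <= 2 ^+ n :> R by rewrite exprn_ege1// ler1n.
  have : 0 <= A' * B' by nra.
  have : a * b <= A' * B' by nra.
  by move: (a * b) (A' * B') (2 ^+ n) k1 => x y z *; nra.
elim: k A B f g => [|k IH] A B f g.
  by move=> [fA _] [gB _]; split=> //; exact: bM.
move=> sf sg; have [/= fA [f' ff' sf']] := sf; have [/= gB [g' gg' sg']] := sg.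
split; first exact: bM.
exists (fun p => f' p * g p + f p * g' p); last first.
  have -> : 2 ^+ k.+1 * 5 * (A * B) = 2 ^+ k * 5 * (A * B) + 2 ^+ k * 5 * (A * B).
    by rewrite exprS; ring.
  apply: smoothD; apply: IH => //; exact: smooth_pred.
move=> p q pr qr.
have f'A := smooth_bounded sf'; have g'B := smooth_bounded sg'.
apply: le_trans (qdiffM r1 fA f'A ff' gB g'B gg' pr qr) _.
have AB0 : 0 <= A * B.
  by rewrite mulr_ge0//; [have := fA p pr|have := gB p pr]; apply: le_trans; exact: cabs_ge0.
have k1 : 1 <= 2 ^+ k.+1 :> R by rewrite exprn_ege1// ler1n.
rewrite ler_wpM2r ?exprn_ge0 ?cabs_ge0// -mulrA ler_peMl// mulr_ge0//.
Qed.

(** [B'] is chosen before [f], so that a whole family with common bounds [B] and [c] gets one bound;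
    [smooth_ratio_factor] relies on this. The induction works because the derivative - f' / f^2
    involves the inverse only to one order less. *)
Lemma smoothV r k B c : r <= 1 -> 0 < c -> exists B', forall f, smooth r k B f ->
  (forall p, cabs p < r -> c <= cabs (f p)) -> smooth r k B' (fun p => (f p)^-1).
Proof.
move=> r1 c0.
have bV f : (forall p, cabs p < r -> c <= cabs (f p)) ->
    bounded_by r (c^-1) (fun p => (f p)^-1).
  move=> fc p pr; rewrite cabsV lef_pV2 ?posrE ?fc//.
  exact: lt_le_trans (fc p pr).
elim: k => [|k [B1 IH]]; first by exists (c^-1) => f _ fc; split=> //; apply: bV.
(* [D] bounds the quadratic remainder of 1/f: its first term comes from the remainder of f, its
   second from q f' times the increment of f. [E] is what three uses of [smoothM] give for the
   derivative. *)
pose D := B * c^-1 ^+ 2 + B * 3 * B * c^-1 ^+ 3.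
pose M1 := 2 ^+ k * 5 * (B1 * B1).
pose E := 2 ^+ k * 5 * (cabs (-1 : C) * (2 ^+ k * 5 * (B * M1))).
exists (c^-1 + `|D| + `|E|) => f sf fc.
have [fB [f' ff' f'B]] := sf.
have ci : 0 < c^-1 by rewrite invr_gt0.
split; first by move=> p pr; apply: le_trans (bV f fc p pr) _; rewrite -addrA lerDl addr_ge0.
exists (fun p => -1 * (f' p * ((f p)^-1 * (f p)^-1))); last first.
  apply: (smoothW (B := E)); first by apply: le_trans (ler_norm _) _; rewrite lerDr addr_ge0// ltW.
  apply: smoothM => //; first exact: smooth_cst.
  have sfV := IH f (smooth_pred sf) fc.
  by apply: smoothM => //; apply: smoothM.
move=> p q pr qr.
have nz s : cabs s < r -> f s != 0.
  by move=> sr; rewrite -cabs_gt0; apply: lt_le_trans c0 (fc s sr).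
have fp0 := nz p pr; have fq0 := nz _ qr.
have -> : (f (p + q))^-1 - (f p)^-1 - q * (-1 * (f' p * ((f p)^-1 * (f p)^-1)))
  = - ((f (p + q) - f p - q * f' p) * ((f (p + q))^-1 * (f p)^-1)) +
    q * f' p * (f (p + q) - f p) * ((f p)^-1 * (f p)^-1 * (f (p + q))^-1).
  by field; rewrite fp0 fq0.
apply: le_trans (cabsD _ _) _; rewrite cabsN !cabsM.
have h1 := qdiff_lip r1 (smooth_bounded f'B) ff' pr qr.
have h2 := ff' p q pr qr; have h3 := smooth_bounded f'B pr.
have h4 := bV f fc p pr; have h5 := bV f fc _ qr.
move: h1 h2 h3 h4 h5.
have := cabs_ge0 q; have := cabs_ge0 (f' p).
have := cabs_ge0 (f (p + q))^-1; have := cabs_ge0 (f p)^-1.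
have := cabs_ge0 (f (p + q) - f p).
have := cabs_ge0 (f (p + q) - f p - q * f' p).
move: ci; rewrite /D; move: (c^-1).
move=> d; move: (cabs q) => a; move: (cabs (f (p + q) - _ - _)) => t.
move: (cabs (f (p + q) - _)) => l; move: (cabs (f p)^-1) => u.
move: (cabs (f (p + q))^-1) => v; move: (cabs (f' p)) => w.
move=> d0 t0 l0 u0 v0 w0 a0 hl ht hw hu hv.
have B0 : 0 <= B by lra.
have e1 : t * (v * u) <= B * a ^+ 2 * (d * d).
  by apply: ler_pM => //; [exact: mulr_ge0|exact: ler_pM].
have e2 : a * w * l * (u * u * v) <= a * B * (3 * B * a) * (d * d * d).
  apply: ler_pM; rewrite ?mulr_ge0//.
    by apply: ler_pM; rewrite ?mulr_ge0// ler_wpM2l.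
  by do 2!(apply: ler_pM; rewrite ?mulr_ge0//).
apply: le_trans (lerD e1 e2) _.
set D' := _ + B * 3 * B * d ^+ 3.
have -> : B * a ^+ 2 * (d * d) + a * B * (3 * B * a) * (d * d * d) = D' * a ^+ 2.
  by rewrite /D'; ring.
apply: ler_wpM2r; first exact: exprn_ge0.
have := ler_norm D'; have := normr_ge0 E; lra.
Qed.

Lemma smoothZ r k B f (a : C) : smooth r k B f ->
  smooth r k (cabs a * B) (fun p => a * f p).
Proof.
elim: k f => [|k IH] f /= [fB f1].
  by split=> // p pr; rewrite cabsM ler_wpM2l ?cabs_ge0 ?fB.
split; first by move=> p pr; rewrite cabsM ler_wpM2l ?cabs_ge0 ?fB.
move: f1 => [f' ff' f'B]; exists (fun p => a * f' p); last exact: IH.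
move=> p q pr qr.
rewrite (_ : _ - _ = a * (f (p + q) - f p - q * f' p)); last by ring.
by rewrite cabsM -mulrA ler_wpM2l ?cabs_ge0 ?ff'.
Qed.

(** Each derivative brings a factor c, but a quadratic remainder brings c^2: hence the exponent
    [k.+1] rather than [k]. *)
Lemma smooth_scale r k B f (c : C) : 1 <= cabs c -> smooth (cabs c * r) k B f ->
  smooth r k (cabs c ^+ k.+1 * B) (fun p => f (c * p)).
Proof.
move=> c1.
have c0 : 0 < cabs c by lra.
have sub p : cabs p < r -> cabs (c * p) < cabs c * r.
  by rewrite cabsM ltr_pM2l.
have bd n D g : bounded_by (cabs c * r) D g ->
    bounded_by r (cabs c ^+ n * D) (fun p => g (c * p)).
  move=> gD p pr; apply: le_trans (gD _ (sub p pr)) _.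
  have D0 : 0 <= D by apply: le_trans (gD _ (sub p pr)); exact: cabs_ge0.
  by rewrite ler_peMl// exprn_ege1.
elim: k B f => [|k IH] B f /= [fB f1]; first by split=> //; exact: bd.
split; first exact: bd.
move: f1 => [f' ff' f'B].
exists (fun p => c * f' (c * p)); last first.
  by rewrite exprS -mulrA; apply: smoothZ; exact: IH.
move=> p q pr qr.
have B0 : 0 <= B by apply: le_trans (fB _ (sub p pr)); exact: cabs_ge0.
rewrite mulrDr (_ : q * _ = c * q * f' (c * p)); last by ring.
apply: le_trans (ff' _ _ (sub _ pr) _) _; first by rewrite -mulrDr sub.
rewrite cabsM exprMn mulrA ler_wpM2r ?exprn_ge0 ?cabs_ge0// mulrC.
by rewrite ler_wpM2r// ler_weXn2l.
Qed.

(** The constant is forgotten here: for the factor [expC (p * L)] it grows with [L], and only the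
    exact value of the derivatives is still wanted. *)
Definition is_qdiff r f f' := exists B,
  [/\ bounded_by r B f, bounded_by r B f' & qdiff r B f f'].

Lemma smooth_is_qdiff r k B f : smooth r k.+1 B f ->
  exists2 f', is_qdiff r f f' & smooth r k B f'.
Proof.
move=> [fB [f' ff' f'B]]; exists f' => //.
by exists B; split=> //; exact: smooth_bounded f'B.
Qed.

Lemma is_qdiff_cst r (c : C) : is_qdiff r (fun=> c) (fun=> 0).
Proof.
exists (cabs c); split=> [p _//|p _|p q _ _]; first by rewrite cabs0 cabs_ge0.
by rewrite subrr mulr0 subr0 cabs0 mulr_ge0 ?exprn_ge0 ?cabs_ge0.
Qed.

Lemma is_qdiffD r f f' g g' : is_qdiff r f f' -> is_qdiff r g g' ->
  is_qdiff r (fun p => f p + g p) (fun p => f' p + g' p).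
Proof.
move=> [A [fA f'A ff']] [B [gB g'B gg']]; exists (A + B); split.
- by move=> p pr; apply: le_trans (cabsD _ _) (lerD (fA p pr) (gB p pr)).
- by move=> p pr; apply: le_trans (cabsD _ _) (lerD (f'A p pr) (g'B p pr)).
- move=> p q pr qr.
  rewrite (_ : _ - _ = (f (p + q) - f p - q * f' p) + (g (p + q) - g p - q * g' p));
    last by ring.
  by rewrite mulrDl; apply: le_trans (cabsD _ _) (lerD (ff' p q pr qr) (gg' p q pr qr)).
Qed.

Lemma is_qdiffM r f f' g g' : r <= 1 -> is_qdiff r f f' -> is_qdiff r g g' ->
  is_qdiff r (fun p => f p * g p) (fun p => f' p * g p + f p * g' p).
Proof.
move=> r1 [A [fA f'A ff']] [B [gB g'B gg']]; exists (5 * (A * B)).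
have bM f1 g1 : bounded_by r A f1 -> bounded_by r B g1 ->
    bounded_by r (A * B) (fun p => f1 p * g1 p).
  by move=> fb gb p pr; rewrite cabsM ler_pM ?cabs_ge0 ?fb ?gb.
have AB0 p : cabs p < r -> 0 <= A * B.
  by move=> pr; rewrite mulr_ge0//; [have := fA p pr|have := gB p pr];
    apply: le_trans; exact: cabs_ge0.
split; last exact: qdiffM.
- by move=> p pr; apply: le_trans (bM _ _ fA gB p pr) _; have := AB0 p pr; lra.
- move=> p pr; apply: le_trans (cabsD _ _) _; have := AB0 p pr.
  by have := bM _ _ fA g'B p pr; have := bM _ _ f'A gB p pr; lra.
Qed.

End Smooth.

(** * Complex series and their domination by real ones *)

Section ComplexSeries.
Variable R : realType.
Local Notation C := R[i].
Implicit Types (u v : nat -> C) (l m : C).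

Definition sums_to u l := forall e : R, 0 < e ->
  exists N, forall n, (N <= n)%N -> cabs (\sum_(k < n) u k - l) < e.

Lemma sums_to_lim u l : sums_to u l -> limn (series u : C^nat) = l.
Proof.
move=> ul; apply: (cvg_lim (@norm_hausdorff _ _)).
apply/cvgrPdist_lt => e; case: e => a b; rewrite ltcE/= => /andP[/eqP -> a0].
have [N NP] := ul a a0; exists N => // n /= Nn.
by rewrite distrC seriesEord normCE ltcR NP.
Qed.

Lemma sums_to_const (x : C) (u := fun n => if n == 0%N then x else 0) : sums_to u x.
Proof.
move=> e e0; exists 1%N => -[//|n] _.
rewrite big_ord_recl/= big1 ?addr0 ?subrr ?cabs0// => i _.
Qed.

Lemma sums_toD u v l m : sums_to u l -> sums_to v m ->
  sums_to (fun n => u n + v n) (l + m).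
Proof.
move=> ul vm e e0; have e20 : 0 < e / 2 by lra.
have [N NP] := ul _ e20; have [M MP] := vm _ e20.
exists (maxn N M) => n; rewrite geq_max => /andP[/NP nN /MP nM].
rewrite big_split/= opprD addrACA.
by apply: le_lt_trans (cabsD _ _) _; lra.
Qed.

Lemma sums_toZ (a : C) u l : sums_to u l -> sums_to (fun n => a * u n) (a * l).
Proof.
move=> ul e e0; have a0 := cabs_ge0 a.
have a10 : 0 < cabs a + 1 by lra.
have [N NP] := ul (e / (cabs a + 1)) (divr_gt0 e0 a10).
exists N => n /NP nN; rewrite -mulr_sumr -mulrBr cabsM.
move: nN; rewrite ltr_pdivlMr//; have := cabs_ge0 (\sum_(k < n) u k - l).
move: (cabs _) (cabs a) a0 => d c c0; nra.
Qed.

(** The factor [c] is kept apart from [B] so that a remainder bound, with [c] equal to |q|^2, passes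
    from the terms to the sum. *)
Lemma sums_to_le u l (B : nat -> R) (c : R) : sums_to u l -> 0 <= c ->
  (forall n, 0 <= B n) -> cvgn (series B) ->
  (forall n, cabs (u n) <= c * B n) -> cabs l <= c * limn (series B).
Proof.
move=> ul c0 B0 cB uB; apply/ler_addgt0Pr => e e0.
have [N /(_ N (leqnn N)) NP] := ul e e0.
have -> : l = \sum_(k < N) u k - (\sum_(k < N) u k - l) by rewrite opprB addrC subrK.
apply: le_trans (cabsB _ _) _; apply: lerD; last exact: ltW.
apply: (@le_trans _ _ (c * series B N)); last first.
  apply: ler_wpM2l => //; apply: nondecreasing_cvgn_le => //.
  by apply: nondecreasing_series => n _ _; exact: B0.
rewrite seriesEord/= mulr_sumr.
elim/big_rec2: _ => [|i y x _ xy]; first by rewrite cabs0.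
by apply: le_trans (cabsD _ _) _; exact: lerD.
Qed.

Lemma sums_to_dominated u (B : nat -> R) : (forall n, cabs (u n) <= B n) ->
  cvgn (series B) -> exists l, sums_to u l.
Proof.
move=> uB cB.
have real_part (f : nat -> R) : (forall n, `|f n| <= B n) ->
    exists l : R, forall e : R, 0 < e ->
      exists N, forall n, (N <= n)%N -> `|\sum_(k < n) f k - l| < e.
  move=> fB; have : cvgn (series f).
    apply: normed_cvg; apply: series_le_cvg cB => // n.
      exact: normr_ge0.
    exact: (le_trans (normr_ge0 _) (fB n)).
  move=> /cvg_ex[l /= fl]; exists l => e e0.
  move/cvgrPdist_lt : fl => /(_ e e0)[N _ NP]; exists N => n /NP /=.
  by rewrite distrC seriesEord.
have [|a aP] := real_part (fun n => complex.Re (u n)).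
  by move=> n; apply: le_trans (uB n); exact: ler_Re_cabs.
have [|b bP] := real_part (fun n => complex.Im (u n)).
  by move=> n; apply: le_trans (uB n); exact: ler_Im_cabs.
exists (a +i* b) => e e0; have e20 : 0 < e / 2 by lra.
have [N NP] := aP _ e20; have [M MP] := bP _ e20.
exists (maxn N M) => n; rewrite geq_max => /andP[/NP nN /MP nM].
apply: le_lt_trans (cabs_le_ReIm _) _.
have reD : {morph @complex.Re R : x y / x + y} by move=> [? ?] [? ?].
have imD : {morph @complex.Im R : x y / x + y} by move=> [? ?] [? ?].
rewrite reD imD /= (big_morph _ reD erefl) (big_morph _ imD erefl); lra.
Qed.

End ComplexSeries.

(** * Termwise differentiation, and the passage from remainder bounds to [derive1] *)

Section SmoothSeries.
Variable R : realType.
Local Notation C := R[i].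

(** The derivatives are dominated by the same summable [B], so their sum exists; the remainder of
    the sum is the sum of the remainders, each at most [B n] times |q|^2. *)
Lemma smooth_series r k (B : nat -> R) (f : nat -> C -> C) (F : C -> C) :
  (forall n, 0 <= B n) -> cvgn (series B) ->
  (forall n, smooth r k (B n) (f n)) ->
  (forall p, cabs p < r -> sums_to (fun n => f n p) (F p)) ->
  smooth r k (limn (series B)) F.
Proof.
move=> B0 cB; elim: k f F => [|k IH] f F fB fF.
  split=> // p pr; rewrite -[leRHS]mul1r; apply: (sums_to_le (fF p pr)) => // n.
  by rewrite mul1r; have [fBn _] := fB n; exact: fBn.
split.
  move=> p pr; rewrite -[leRHS]mul1r; apply: (sums_to_le (fF p pr)) => // n.
  by rewrite mul1r; have [fBn _] := fB n; exact: fBn.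
have /choice[f' f'P] : forall n, exists f', qdiff r (B n) (f n) f' /\
    smooth r k (B n) f'.
  by move=> n; have [_ [f' ? ?]] := fB n; exists f'.
have /choice[F' F'P] : forall p, exists l, cabs p < r ->
    sums_to (fun n => f' n p) l.
  move=> p; have [pr|pr] := boolP (cabs p < r); last by exists 0.
  have [|l lP] := @sums_to_dominated _ (fun n => f' n p) B _ cB; last by exists l.
  by move=> n; have [_ sf'] := f'P n; exact: (smooth_bounded sf' pr).
exists F'; last by apply: IH F'P => n; have [] := f'P n.
move=> p q pr qr.
have e1 := fF _ qr; have e2 := sums_toZ (-1) (fF _ pr).
have e3 := sums_toZ (- q) (F'P _ pr).
have := sums_toD (sums_toD e1 e2) e3.
rewrite mulN1r mulNr => e4; rewrite [leRHS]mulrC.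
apply: (sums_to_le e4) => // [|n]; first by rewrite exprn_ge0// cabs_ge0.
by rewrite mulN1r mulNr [leRHS]mulrC; have [ff' _] := f'P n; exact: ff'.
Qed.

Lemma derive1_qdiff (r B : R) (F h h' : C -> C) p :
  (forall p, cabs p < r -> F p = h p) -> qdiff r B h h' -> cabs p < r ->
  derive1 F p = h' p.
Proof.
move=> Fh hh' pr; rewrite /derive1; apply: (cvg_lim (@norm_hausdorff _ _)).
apply/cvgrPdist_lt => e; case: e => a b; rewrite ltcE/= => /andP[/eqP -> a0].
have B10 : 0 < `|B| + 1 by have := normr_ge0 B; lra.
near=> q.
have q0 : q != 0 by near: q; exact: nbhs_dnbhs_neq.
have q1 : cabs q < r - cabs p.
  rewrite -ltcR -normCE; near: q; apply: dnbhs0_lt.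
  by rewrite ltcR subr_gt0.
have q2 : cabs q < a / (`|B| + 1).
  by rewrite -ltcR -normCE; near: q; apply: dnbhs0_lt; rewrite ltcR divr_gt0.
have pqr : cabs (p + q) < r by apply: le_lt_trans (cabsD _ _) _; lra.
rewrite distrC normCE ltcR (addrC q p) !Fh//.
have -> : q^-1 *: (h (p + q) - h p) - h' p = q^-1 * (h (p + q) - h p - q * h' p).
  by rewrite [RHS]mulrBr mulKf.
rewrite cabsM cabsV mulrC ltr_pdivrMr ?cabs_gt0//.
apply: le_lt_trans (hh' p q pr pqr) _; rewrite expr2 mulrA.
rewrite ltr_pM2r ?cabs_gt0//.
move: q2; rewrite ltr_pdivlMr//; have := ler_norm B; have := cabs_ge0 q.
move: (cabs q) (`|B|) => t c; nra.
Unshelve. all: by end_near. Qed.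

(** Differentiation is local and the ball is open, so agreement of [F] with [h 0] on the ball alone
    propagates to all derivatives there. *)
Lemma derive1n_qdiff (r : R) n (F : C -> C) (h : nat -> C -> C) :
  (forall p, cabs p < r -> F p = h 0%N p) ->
  (forall j, (j < n)%N -> is_qdiff r (h j) (h j.+1)) ->
  forall p, cabs p < r -> derive1n n F p = h n p.
Proof.
move=> Fh; elim: n => [|n IH] hh p pr; first exact: Fh.
have [B [_ _ hB]] := hh n (leqnn _).
rewrite derive1nS; apply: derive1_qdiff hB pr => {}p; apply: IH => j jn.
exact/hh/ltnW.
Qed.

End SmoothSeries.

(** * The complex exponential and its first-order Taylor estimate *)

Section ComplexExponential.
Variable R : realType.
Local Notation C := R[i].
Implicit Types (z : C) (a b : R).

Lemma ReD (x y : C) : complex.Re (x + y) = complex.Re x + complex.Re y.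
Proof. by case: x y => [? ?] [? ?]. Qed.

Lemma ImD (x y : C) : complex.Im (x + y) = complex.Im x + complex.Im y.
Proof. by case: x y => [? ?] [? ?]. Qed.

Lemma ReMR (x : C) a : complex.Re (x * a%:C) = complex.Re x * a.
Proof. by case: x => ? ?; rewrite /= mulr0 subr0. Qed.

Lemma ImMR (x : C) a : complex.Im (x * a%:C) = complex.Im x * a.
Proof. by case: x => ? ?; rewrite /= mulr0 add0r. Qed.

Lemma expC0 : expC 0 = 1 :> C.
Proof. by rewrite /expC/= expR0 cos0 sin0 mulr0 mulr1. Qed.

Lemma expCD (x y : C) : expC (x + y) = expC x * expC y.
Proof.
case: x y => [a b] [c d]; rewrite /expC /= expRD cosD sinD.
by apply/eqP; rewrite eq_complex/=; apply/andP; split; apply/eqP; ring.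
Qed.

Lemma cabs_expC z : cabs (expC z) = expR (complex.Re z).
Proof.
rewrite cabsE /expC/= !exprMn -mulrDr cos2Dsin2 mulr1 sqrtr_sqr.
by rewrite ger0_norm// expR_ge0.
Qed.

Lemma expC_natM n z : expC (n%:R * z) = expC z ^+ n.
Proof.
elim: n => [|n IH]; first by rewrite mul0r expC0.
by rewrite exprS -IH -expCD -natr1 mulrDl mul1r addrC.
Qed.

Lemma expCR a : expC a%:C = (expR a)%:C :> C.
Proof. by rewrite /expC /= cos0 sin0 mulr0 mulr1. Qed.

Lemma mean_value_bound (f df : R -> R) b (M : R) :
  (forall x : R, is_derive x 1 f (df x)) ->
  (forall c, `|c| <= `|b| -> `|df c| <= M) -> `|f b - f 0| <= M * `|b|.
Proof.
move=> fdf dfM.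
have cf : continuous f.
  by move=> x; apply: differentiable_continuous; apply/derivable1_diffP; have [] := fdf x.
have mvt u v : u <= v -> exists2 c, c \in `[u, v] & f v - f u = df c * (v - u).
  move=> uv; apply: MVT_segment => //.
  exact: continuous_subspaceT.
have [b0|b0] := leP 0 b.
  have [c] := mvt _ _ b0.
  rewrite in_itv/= subr0 => /andP[c0 cb] ->; rewrite normrM ler_wpM2r//.
  by rewrite dfM// !ger0_norm.
have [c] := mvt _ _ (ltW b0).
rewrite in_itv/= sub0r => /andP[c0 cb] e; rewrite distrC e normrM normrN ler_wpM2r//.
by rewrite dfM// !ler0_norm ?lerN2// ltW.
Qed.

Lemma norm_sin_le b : `|sin b| <= `|b|.
Proof.
rewrite -[sin b]subr0 -{1}sin0 -[leRHS]mul1r.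
by apply: (@mean_value_bound _ cos) => c _; exact: cos_max.
Qed.

Lemma norm_cosB1_le b : `|cos b - 1| <= `|b|.
Proof.
rewrite -{1}cos0 -[leRHS]mul1r.
by apply: (@mean_value_bound _ (fun x => - sin x)) => c _; rewrite normrN sin_max.
Qed.

Lemma norm_cosB1_le_sqr b : `|cos b - 1| <= b ^+ 2.
Proof.
rewrite -{1}cos0 -real_normK ?num_real// expr2.
apply: (@mean_value_bound _ (fun x => - sin x)) => c cb.
by rewrite normrN (le_trans (norm_sin_le _)).
Qed.

Lemma norm_sinB_le_sqr b : `|sin b - b| <= b ^+ 2.
Proof.
rewrite -real_normK ?num_real// expr2 (_ : sin b - b = (sin b - b) - (sin 0 - 0)); last first.
  by rewrite sin0 !subr0.
apply: (@mean_value_bound (fun x => sin x - x) (fun x => cos x - 1)) => c cb.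
by rewrite (le_trans (norm_cosB1_le _)).
Qed.

(** This is 1 - a <= e^(-a) multiplied by e^a. *)
Lemma expRB1_le a : expR a - 1 <= a * expR a.
Proof.
have := expR_ge1Dx (- a); have := expR_gt0 a; have := expRxMexpNx_1 a.
move: (expR a) (expR (- a)) => x y; nra.
Qed.

Lemma expR_abs_ge a : expR a <= expR `|a|.
Proof. by rewrite ler_expR ler_norm. Qed.

Lemma norm_expRB1_le a : `|expR a - 1| <= `|a| * expR `|a|.
Proof.
have h1 := expRB1_le a; have h2 := expR_ge1Dx a; have h3 := expR_abs_ge a.
have h4 : 1 <= expR `|a| by rewrite -expR0 ler_expR.
have h5 := expR_gt0 a.
rewrite ler_norml; have [a0|a0] := leP 0 a.
  move: h3 h4; rewrite (ger0_norm a0) => _.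
  by move: (expR a) h1 h2 h5 => y *; apply/andP; split; nra.
move: h3 h4; rewrite (ltr0_norm a0).
by move: (expR a) (expR (- a)) h1 h2 h5 => y z *; apply/andP; split; nra.
Qed.

Lemma expRB1B_le a : `|expR a - 1 - a| <= a ^+ 2 * expR `|a|.
Proof.
have h1 := expRB1_le a; have h2 := expR_ge1Dx a; have h3 := norm_expRB1_le a.
rewrite ger0_norm; last by lra.
have h6 : expR a - 1 - a <= a * (expR a - 1) by lra.
apply: le_trans h6 (le_trans (ler_norm _) _).
by rewrite normrM -real_normK ?num_real// expr2 -mulrA ler_wpM2l.
Qed.

(** The real and imaginary parts split into two terms each, and each of the four is at most |z|^2
    e^|z|. *)
Lemma expC_taylor1 z : cabs (expC z - 1 - z) <= 4 * cabs z ^+ 2 * expR (cabs z).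
Proof.
case: z => a b; set c := cabs (a +i* b).
have ac : `|a| <= c := ler_Re_cabs (a +i* b).
have bc : `|b| <= c := ler_Im_cabs (a +i* b).
set E := expR c.
have E0 : 0 < E := expR_gt0 _.
have aE : expR `|a| <= E by rewrite ler_expR.
have aE' : expR a <= E by apply: le_trans aE; exact: expR_abs_ge.
have a0 := expR_gt0 a.
have c0 : 0 <= c := cabs_ge0 _.
have c2a : a ^+ 2 <= c ^+ 2 by rewrite -real_normK ?num_real// lerXn2r ?nnegrE.
have c2b : b ^+ 2 <= c ^+ 2 by rewrite -real_normK ?num_real// lerXn2r ?nnegrE.
apply: le_trans (cabs_le_ReIm _) _; rewrite /= subr0.
have -> : expR a * cos b - 1 - a = (expR a - 1 - a) + expR a * (cos b - 1) by ring.
have -> : expR a * sin b - b = expR a * (sin b - b) + (expR a - 1) * b by ring.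
have e1 : `|expR a - 1 - a| <= c ^+ 2 * E.
  by apply: le_trans (expRB1B_le a) _; rewrite ler_pM ?sqr_ge0 ?expR_ge0.
have e2 : `|expR a * (cos b - 1)| <= c ^+ 2 * E.
  rewrite normrM mulrC ler_pM// ?(gtr0_norm a0)//.
  exact: le_trans (norm_cosB1_le_sqr b) _.
have e3 : `|expR a * (sin b - b)| <= c ^+ 2 * E.
  rewrite normrM mulrC ler_pM// ?(gtr0_norm a0)//.
  exact: le_trans (norm_sinB_le_sqr b) _.
have e4 : `|(expR a - 1) * b| <= c ^+ 2 * E.
  rewrite normrM expr2 mulrAC ler_pM//; apply: le_trans (norm_expRB1_le a) _.
  by rewrite ler_pM ?expR_ge0.
apply: le_trans (lerD (ler_normD _ _) (ler_normD _ _)) _; lra.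
Qed.

End ComplexExponential.

(** * The fundamental theorem of calculus on the open half-line *)

Section PositiveAxisIntegral.
Variable R : realType.
Local Notation mu := (@lebesgue_measure R).
Local Notation D := (`]0%R, +oo[%classic : set R).

(** The shift by 2 makes every interval nondegenerate, including the one for n = 0, as the
    fundamental theorem on a segment requires. *)
Let A (n : nat) : set R := `[n.+2%:R^-1, n.+2%:R]%classic.

Lemma posaxisE (x : R) : D x <-> 0 < x.
Proof. by rewrite /= in_itv/= andbT. Qed.

Lemma measurable_posaxis : measurable (D : set (measurableTypeR R)).
Proof. exact: measurable_itv. Qed.

Let A_pos n x : A n x -> 0 < x.
Proof. by rewrite /A /= in_itv/= => /andP[+ _]; apply: lt_le_trans; rewrite invr_gt0. Qed.

Let A_nondecreasing : nondecreasing_seq A.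
Proof.
apply/nondecreasing_seqP => n; apply/subsetPset => x; rewrite /A /= !in_itv/= => /andP[h1 h2].
apply/andP; split; last by apply: le_trans h2 _; rewrite ler_nat.
by apply: le_trans h1; rewrite lef_pV2 ?posrE ?ltr0n// ler_nat.
Qed.

Let A_bigcup : \bigcup_n A n = D.
Proof.
apply/seteqP; split=> x; first by move=> [n _ /A_pos x0]; apply/posaxisE.
move=> /posaxisE x0.
pose n := maxn (Num.bound x) (Num.bound x^-1).
have h1 : x < n.+2%:R.
  apply: (lt_le_trans (archi_boundP (ltW x0))); rewrite ler_nat.
  by do 2!apply: leqW; exact: leq_maxl.
have h2 : x^-1 < n.+2%:R.
  have xV : 0 <= x^-1 by rewrite invr_ge0 ltW.
  apply: (lt_le_trans (archi_boundP xV)); rewrite ler_nat.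
  by do 2!apply: leqW; exact: leq_maxr.
exists n => //; rewrite /A /= in_itv/= (ltW h1) andbT ltW//.
by rewrite invf_plt ?posrE ?ltr0n.
Qed.

Variables (F f : R -> R).
Hypothesis Ff : forall x : R, 0 < x -> is_derive x 1 F (f x).
Hypothesis cf : forall x : R, 0 < x -> {for x, continuous f}.

Let F_continuous (x : R) : 0 < x -> {for x, continuous F}.
Proof.
by move=> x0; apply: differentiable_continuous; apply/derivable1_diffP; have [] := Ff x0.
Qed.

Lemma measurable_fun_posaxis : measurable_fun D f.
Proof.
apply: open_continuous_measurable_fun => // x; rewrite inE => /posaxisE; exact: cf.
Qed.

Let integral_A n : (\int[mu]_(x in A n) (f x)%:E = (F n.+2%:R)%:E - (F n.+2%:R^-1)%:E)%E.
Proof.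
have n0 : 0 < n.+2%:R^-1 :> R by rewrite invr_gt0.
apply: continuous_FTC2.
- by rewrite (@lt_trans _ _ 1)// ?invf_lt1 ?ltr1n// ltr0n.
- apply: continuous_in_subspaceT => x; rewrite inE => /A_pos; exact: cf.
- split.
  + by move=> x; rewrite in_itv/= => /andP[+ _] => /(lt_trans n0)/Ff[].
  + by apply: cvg_at_right_filter; exact: F_continuous.
  + by apply: cvg_at_left_filter; apply: F_continuous; rewrite ltr0n.
- move=> x; rewrite in_itv/= => /andP[+ _] => /(lt_trans n0) x0.
  by rewrite derive1E; have [_ ->] := Ff x0.
Qed.

(** By monotone convergence along [A n]: the integral over each interval is a difference of two
    values of [F], hence at most 2M. *)
Lemma integrable_of_bounded_primitive (M : R) : (forall x, 0 < x -> 0 <= f x) ->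
  (forall x, 0 < x -> `|F x| <= M) -> mu.-integrable D (EFin \o f).
Proof.
move=> f0 FM; apply/integrableP; split.
  by apply/measurable_EFinP; exact: measurable_fun_posaxis.
rewrite (_ : (\int[mu]_(x in D) _)%E = (\int[mu]_(x in D) (f x)%:E)%E); last first.
  by apply: eq_integral => x; rewrite inE => /posaxisE x0; rewrite /= ger0_norm ?f0.
apply: (@le_lt_trans _ _ (M + M)%:E); last exact: ltry.
have := @ge0_nondecreasing_set_cvg_integral _ (measurableTypeR R) R A (EFin \o f)
  lebesgue_measure A_nondecreasing.
rewrite A_bigcup => cvgA.
apply: (cvge_to_le (cvgA _ _ _)) => [n|n|n x /A_pos x0|].
- exact: measurable_itv.
- apply: (@measurable_funS _ _ _ _ D) => // [x /A_pos/posaxisE//|].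
  by apply/measurable_EFinP; exact: measurable_fun_posaxis.
- by rewrite lee_fin f0.
apply: nearW => n /=; rewrite integral_A -EFinB lee_fin.
have h1 := FM n.+2%:R (ltr0Sn _ _).
have h2 : `|F n.+2%:R^-1| <= M by apply: FM; rewrite invr_gt0.
by move: h1 h2; rewrite !ler_norml => /andP[_ ?] /andP[? _]; lra.
Qed.

(** Dominated convergence of the restrictions of [f] to [A n], with |f| itself as the dominating
    function. *)
Lemma Rintegral_posaxis (a b : R) : mu.-integrable D (EFin \o f) ->
  F (n.+2%:R^-1) @[n --> \oo] --> a -> F (n.+2%:R) @[n --> \oo] --> b ->
  \int[mu]_(x in D) f x = b - a.
Proof.
move=> fi Fa Fb.
pose g n := (EFin \o f) \_ (A n).
have mf := measurable_int mu fi.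
have mA n : measurable (A n) by exact: measurable_itv.
have AD n : A n `<=` D by move=> x /A_pos/posaxisE.
have [||||||_ _] := @dominated_convergence _ (measurableTypeR R) R
  lebesgue_measure D _ g (EFin \o f) (abse \o (EFin \o f)).
- by [].
- move=> n; apply/(measurable_restrict _ (mA n)) => //.
  by apply: measurable_funS mf.
- exact: mf.
- apply: aeW => x Dx.
  have [m _ Am] : (\bigcup_n A n) x by rewrite A_bigcup.
  apply: cvg_near_cst; exists m => // n /= mn.
  rewrite /g patchE mem_set//.
  by have /subsetPset := A_nondecreasing mn; apply.
- exact: integrable_abse.
- apply: aeW => x n _; rewrite /g patchE; case: ifPn => //= _.
  by rewrite normr0 lee_fin.
rewrite /g => h.
rewrite /Rintegral.
have -> : (\int[mu]_(x in D) (f x)%:E)%E = (b - a)%:E; last by [].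
have FAB : [sequence (\int[mu]_(x in D) ((EFin \o f) \_ (A n)) x)%E]_n =
    EFin \o (fun n => F n.+2%:R - F n.+2%:R^-1).
  by apply/funext => n /=; rewrite -integral_mkcondr setIidr// integral_A.
rewrite FAB in h.
rewrite -(cvg_lim (@ereal_hausdorff _) h); apply/cvg_lim => //.
apply: cvg_EFin; first exact: nearW.
exact: cvgB.
Qed.

End PositiveAxisIntegral.

(** * Integrability and boundary behaviour of t^(s-1) e^-t *)

Section GammaWeight.
Variable R : realType.
Local Notation mu := (@lebesgue_measure R).
Local Notation D := (`]0%R, +oo[%classic : set R).
Implicit Types s t : R.

Definition gamma_weight s t := expR ((s - 1) * ln t - t).

Lemma continuous_of_is_derive (f : R -> R) t d : is_derive t 1 f d -> {for t, continuous f}.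
Proof.
by move=> fd; apply: differentiable_continuous; apply/derivable1_diffP; have [] := fd.
Qed.

(** In other words t^s <= K e^(et), with K = (s/e)^s: apply ln u <= u to u = e t / s. *)
Lemma expR_lnM_le s e : 0 < s -> 0 < e ->
  exists2 K : R, 0 < K & forall t, 0 < t -> expR (s * ln t) <= K * expR (e * t).
Proof.
move=> s0 e0; exists (expR (s * ln (s / e))); first exact: expR_gt0.
move=> t t0; rewrite -expRD ler_expR.
have se0 : 0 < s / e by rewrite divr_gt0.
have t1 : 0 < t / (s / e) by rewrite divr_gt0.
have -> : ln t = ln (t / (s / e)) + ln (s / e).
  by rewrite -lnM ?posrE// divfK// gt_eqF.
rewrite mulrDr addrC lerD2l.
have := ln_sublinear t1 => /ltW; rewrite -(ler_pM2l s0) => /le_trans; apply.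
have -> : t / (s / e) = e * t / s by field; rewrite !gt_eqF.
by rewrite mulrC divfK// gt_eqF.
Qed.

Lemma expRln t : 0 < t -> expR (ln t) = t.
Proof. by move=> t0; rewrite lnK ?posrE. Qed.

Lemma integrable_gamma_weight s : 0 < s -> mu.-integrable D (EFin \o gamma_weight s).
Proof.
move=> s0.
(* [- (1 + t^s)^-1] is bounded and its derivative dominates t^(s-1) e^-t. *)
pose F t := - (1 + expR (s * ln t))^-1.
pose f t := s * expR ((s - 1) * ln t) * (1 + expR (s * ln t))^-1 ^+ 2.
have e1 t : 0 < 1 + expR (s * ln t) by have := expR_gt0 (s * ln t); lra.
have dln t : 0 < t -> is_derive t 1 (@ln R) t^-1 by exact: is_derive1_ln.
have dV t : 0 < t -> is_derive t 1 (fun y => (1 + expR (s * ln y))^-1)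
    (- (1 + expR (s * ln t)) ^- 2 *: (expR (s * ln t) * (s *: t^-1))).
  move=> /dln dlnt; apply: is_deriveV; first by rewrite gt_eqF.
  by apply: is_derive_eq; rewrite add0r mul1r.
have dF t : 0 < t -> is_derive t 1 F (f t).
  move=> t0; have dVt := dV t t0; rewrite /F; apply: is_derive_eq.
  rewrite /f mulrBl mul1r expRB expRln// /GRing.scale/= exprVn.
  by field; rewrite (gt_eqF t0) gt_eqF.
have cf t : 0 < t -> {for t, continuous f}.
  move=> t0; have dVt := dV t t0; have dlnt := dln t t0.
  rewrite /f; apply: continuous_of_is_derive; apply: is_derive_eq; reflexivity.
have f0 t : 0 < t -> 0 <= f t.
  by move=> _; rewrite /f !mulr_ge0 ?expR_ge0 ?exprn_ge0 ?invr_ge0 ?(ltW s0) ?ltW.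
have F1 t : 0 < t -> `|F t| <= 1.
  move=> _; rewrite /F normrN gtr0_norm ?invr_gt0// invf_le1//.
  by have := expR_gt0 (s * ln t); lra.
have fi := integrable_of_bounded_primitive dF cf f0 F1.
have cg t : 0 < t -> {for t, continuous (gamma_weight s)}.
  move=> t0; have dlnt := dln t t0.
  by rewrite /gamma_weight; apply: continuous_of_is_derive; apply: is_derive_eq; reflexivity.
(* From t^s <= K e^(t/2) follows 1 + t^s <= (1 + K) e^(t/2). Squaring gives e^-t <= (1 + K)^2 / (1 +
   t^s)^2, whence the exponent 1/2 and the factor s^-1 (1 + K)^2 below. *)
have e20 : (0 : R) < 2^-1 by lra.
have [K K0 KP] := expR_lnM_le s0 e20.
have K1 : 0 <= 1 + K by lra.
have s0' : 0 <= s by lra.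
have sV0 : 0 <= s^-1 by rewrite invr_ge0.
have := integrableZl (@measurable_posaxis R) (s^-1 * (1 + K) ^+ 2) fi.
apply: le_integrable; first exact: (@measurable_posaxis R).
  by apply/measurable_EFinP; exact: measurable_fun_posaxis.
move=> t /posaxisE t0; rewrite /= lee_fin.
have c0 : 0 <= s^-1 * (1 + K) ^+ 2 by rewrite mulr_ge0// sqr_ge0.
rewrite [leLHS]ger0_norm ?expR_ge0// [leRHS]ger0_norm ?mulr_ge0 ?f0//.
rewrite /gamma_weight /f expRD expRN.
have -> : s^-1 * (1 + K) ^+ 2 * (s * expR ((s - 1) * ln t) * (1 + expR (s * ln t))^-1 ^+ 2)
  = expR ((s - 1) * ln t) * ((1 + K) / (1 + expR (s * ln t))) ^+ 2.
  by field; rewrite (gt_eqF s0) gt_eqF.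
rewrite ler_wpM2l ?expR_ge0//.
have -> : (expR t)^-1 = ((expR (2^-1 * t))^-1) ^+ 2.
  by rewrite exprVn -expRM_natl; congr (expR _)^-1; field.
rewrite lerXn2r ?nnegrE ?invr_ge0 ?expR_ge0 ?divr_ge0 ?(ltW (e1 t))//.
rewrite ler_pdivlMr// mulrC ler_pdivrMr ?expR_gt0//.
have := KP t t0; have : 1 <= expR (2^-1 * t) by rewrite -expR0 ler_expR mulr_ge0// ltW.
by move=> h1 h2; rewrite mulrDl mul1r; exact: lerD.
Qed.

Lemma cvg_gamma_boundary_0 s : 0 < s ->
  expR (s * ln (n.+2%:R^-1)) @[n --> \oo] --> (0 : R).
Proof.
move=> s0.
have h : (n.+2%:R^-1 : R) `^ s @[n --> \oo] --> (0 : R).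
  have /cvg_at_rightP h := @powR_cvg0 R s s0.
  apply: (h (fun n => n.+2%:R^-1)); split; first by move=> n; rewrite invr_gt0.
  by have := @cvg_harmonic R; rewrite -cvg_shiftS.
apply: cvg_trans h; apply: near_eq_cvg; apply: nearW => n /=.
by rewrite /powR gt_eqF ?invr_gt0.
Qed.

(** Half of the exponential absorbs t^s, and the other half, e^(-t/2), is at most 2/t. *)
Lemma cvg_gamma_boundary_y s : 0 < s ->
  expR (s * ln (n.+2%:R) - n.+2%:R) @[n --> \oo] --> (0 : R).
Proof.
move=> s0; have e20 : (0 : R) < 2^-1 by lra.
have [K K0 KP] := expR_lnM_le s0 e20.
apply: (@squeeze_cvgr _ _ _ _ (fun=> 0) (fun n => K * 2 * n.+2%:R^-1)).
- apply: nearW => n; rewrite expR_ge0/= expRD.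
  have n0 : 0 < n.+2%:R :> R by [].
  apply: le_trans (ler_wpM2r (expR_ge0 _) (KP _ n0)) _.
  rewrite -!mulrA -expRD ler_wpM2l ?(ltW K0)//.
  have -> : 2^-1 * n.+2%:R - n.+2%:R = - (2^-1 * n.+2%:R) :> R by field.
  rewrite expRN -[leRHS]invrK lef_pV2 ?posrE ?expR_gt0//.
  by rewrite invfM invrK; have := expR_ge1Dx (2^-1 * n.+2%:R : R); lra.
- exact: cvg_cst.
- rewrite -[X in _ --> X](mulr0 (K * 2)); apply: cvgMl_tmp.
  by have := @cvg_harmonic R; rewrite -cvg_shiftS.
Qed.

End GammaWeight.

(** * Integrals of complex-valued functions over the half-line *)

Section ComplexIntegral.
Variable R : realType.
Local Notation C := R[i].
Local Notation mu := (@lebesgue_measure R).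
Local Notation D := (`]0%R, +oo[%classic : set R).
Implicit Types (f g : R -> C) (G : R -> R).

Definition cint f : C :=
  (\int[mu]_(t in D) complex.Re (f t)) +i* (\int[mu]_(t in D) complex.Im (f t)).

Definition cmeasurable f :=
  measurable_fun D (fun t => complex.Re (f t)) /\
  measurable_fun D (fun t => complex.Im (f t)).

Definition cintegrable f :=
  mu.-integrable D (EFin \o (fun t => complex.Re (f t))) /\
  mu.-integrable D (EFin \o (fun t => complex.Im (f t))).

Let mD := @measurable_posaxis R.

Lemma eq_cint f g : (forall t, 0 < t -> f t = g t) -> cint f = cint g.
Proof.
by move=> fg; congr Complex; apply: eq_Rintegral => t; rewrite inE => /posaxisE /fg ->.
Qed.

Lemma cintegrable_dominated f G : cmeasurable f -> mu.-integrable D (EFin \o G) ->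
  (forall t, 0 < t -> cabs (f t) <= G t) -> cintegrable f.
Proof.
move=> [mr mi] iG fG; split.
- apply: le_integrable iG => //; first exact/measurable_EFinP.
  move=> t /posaxisE t0; rewrite /= lee_fin; apply: le_trans (ler_norm _).
  exact: le_trans (ler_Re_cabs _) (fG t t0).
- apply: le_integrable iG => //; first exact/measurable_EFinP.
  move=> t /posaxisE t0; rewrite /= lee_fin; apply: le_trans (ler_norm _).
  exact: le_trans (ler_Im_cabs _) (fG t t0).
Qed.

Lemma cintD f g : cintegrable f -> cintegrable g ->
  cint (fun t => f t + g t) = cint f + cint g.
Proof.
move=> [f1 f2] [g1 g2]; rewrite /cint.
under eq_Rintegral do rewrite ReD.
under [X in _ +i* X = _]eq_Rintegral do rewrite ImD.
by rewrite !RintegralD.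
Qed.

Lemma cintegrableD f g : cintegrable f -> cintegrable g ->
  cintegrable (fun t => f t + g t).
Proof.
move=> [f1 f2] [g1 g2]; split.
- apply: eq_integrable (integrableD mD f1 g1) => //.
  by move=> t _; rewrite /= ReD EFinD.
- apply: eq_integrable (integrableD mD f2 g2) => //.
  by move=> t _; rewrite /= ImD EFinD.
Qed.

Lemma cintegrableZ (c : C) f : cintegrable f -> cintegrable (fun t => c * f t).
Proof.
case: c => a b [f1 f2]; split.
- apply: eq_integrable (integrableB mD (integrableZl mD a f1) (integrableZl mD b f2)) => //.
  by move=> t _ /=; case: (f t) => x y /=; rewrite EFinB !EFinM.
- apply: eq_integrable (integrableD mD (integrableZl mD a f2) (integrableZl mD b f1)) => //.
  by move=> t _ /=; case: (f t) => x y /=; rewrite EFinD !EFinM.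
Qed.

Lemma cintZ (c : C) f : cintegrable f -> cint (fun t => c * f t) = c * cint f.
Proof.
case: c => a b [f1 f2].
have iZ k h : mu.-integrable D (EFin \o h) -> mu.-integrable D (EFin \o (fun t => k * h t)).
  by move=> /(integrableZl mD k); apply: eq_integrable => // t _; rewrite /= EFinM.
transitivity ((\int[mu]_(t in D) (a * complex.Re (f t) - b * complex.Im (f t))) +i*
              (\int[mu]_(t in D) (a * complex.Im (f t) + b * complex.Re (f t)))).
  by congr Complex; apply: eq_Rintegral => t _; case: (f t).
by rewrite RintegralB ?RintegralD ?RintegralZl//; apply: iZ.
Qed.

(** The factor 2 comes from bounding the real and imaginary parts separately; a sharp constant would
    gain nothing. *)
Lemma cabs_cint_le f G : cintegrable f -> mu.-integrable D (EFin \o G) ->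
  (forall t, 0 < t -> cabs (f t) <= G t) ->
  cabs (cint f) <= 2 * \int[mu]_(t in D) G t.
Proof.
move=> [f1 f2] iG fG.
have bound (h : R -> R) : mu.-integrable D (EFin \o h) ->
    (forall t, 0 < t -> `|h t| <= G t) ->
    `|\int[mu]_(t in D) h t| <= \int[mu]_(t in D) G t.
  move=> ih hG; apply: le_trans (le_normr_Rintegral mD ih) _.
  apply: le_Rintegral => //.
    apply: eq_integrable (integrable_abse ih) => //.
  by move=> t /posaxisE; exact: hG.
apply: le_trans (cabs_le_ReIm _) _; rewrite /cint /= mulr2n mulrDl mul1r.
apply: lerD; apply: bound => // t t0; apply: le_trans (fG t t0).
  exact: ler_Re_cabs.
exact: ler_Im_cabs.
Qed.

End ComplexIntegral.

(** * The Gamma function *)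

Section GammaFunction.
Variable R : realType.
Local Notation C := R[i].
Local Notation mu := (@lebesgue_measure R).
Local Notation D := (`]0%R, +oo[%classic : set R).
Implicit Types (p q z : C) (t : R).

(** This is (ln t)^k t^p e^-t, the k-th derivative in p of the integrand of Gamma(1 + p). *)
Definition mellin_kernel (k : nat) p t : C :=
  (ln t ^+ k)%:C * expC (p * (ln t)%:C - t%:C).

Lemma mellin_kernelS k p t :
  mellin_kernel k.+1 p t = (ln t)%:C * mellin_kernel k p t.
Proof. by rewrite /mellin_kernel exprS rmorphM mulrA. Qed.

Lemma Re_ln_sub p t : complex.Re (p * (ln t)%:C - t%:C) = complex.Re p * ln t - t.
Proof. by rewrite ReD ReMR. Qed.

Lemma Im_ln_sub p t : complex.Im (p * (ln t)%:C - t%:C) = complex.Im p * ln t.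
Proof. by rewrite ImD ImMR /= oppr0 addr0. Qed.

Lemma cabs_mellin_kernel k p t :
  cabs (mellin_kernel k p t) = `|ln t| ^+ k * expR (complex.Re p * ln t - t).
Proof. by rewrite /mellin_kernel cabsM cabsR cabs_expC Re_ln_sub normrX. Qed.

Lemma cmeasurable_mellin k p : cmeasurable (mellin_kernel k p).
Proof.
have me : measurable_fun D (fun t => ln t ^+ k * expR (complex.Re p * ln t - t)).
  apply: measurable_funTS; apply: measurable_funM.
    by apply: measurable_funX; exact: measurable_ln.
  apply: measurableT_comp; first exact: measurable_expR.
  apply: measurable_funB => //; apply: measurable_funM => //; exact: measurable_ln.
have ml : measurable_fun D (fun t => complex.Im p * ln t).
  apply: measurable_funTS; apply: measurable_funM => //; exact: measurable_ln.
split.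
- rewrite (_ : (fun t => _) = (fun t => ln t ^+ k * expR (complex.Re p * ln t - t) *
    cos (complex.Im p * ln t))); last first.
    apply/funext => t; rewrite /mellin_kernel mulrC ReMR /expC /= Re_ln_sub Im_ln_sub.
    by ring.
  apply: measurable_funM => //; apply: measurableT_comp => //.
  by apply: continuous_measurable_fun; exact: continuous_cos.
- rewrite (_ : (fun t => _) = (fun t => ln t ^+ k * expR (complex.Re p * ln t - t) *
    sin (complex.Im p * ln t))); last first.
    apply/funext => t; rewrite /mellin_kernel mulrC ImMR /expC /= Re_ln_sub Im_ln_sub.
    by ring.
  apply: measurable_funM => //; apply: measurableT_comp => //.
  by apply: continuous_measurable_fun; exact: continuous_sin.
Qed.

Lemma GammaE z : Gamma z = cint (mellin_kernel 0 (z - 1)).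
Proof. by apply: eq_cint => t _; rewrite /mellin_kernel expr0 mul1r. Qed.

Lemma cintegrable_mellin0 p : -1 < complex.Re p -> cintegrable (mellin_kernel 0 p).
Proof.
move=> p1; apply: (@cintegrable_dominated _ _ (gamma_weight (complex.Re p + 1))).
- exact: cmeasurable_mellin.
- by apply: integrable_gamma_weight; lra.
- by move=> t t0; rewrite cabs_mellin_kernel expr0 mul1r /gamma_weight addrK.
Qed.

(** Integration by parts; t^z e^-t vanishes at 0 because Re z > 0 and at infinity because of the
    exponential. *)
Lemma Gamma_recursion z : 0 < complex.Re z -> Gamma (1 + z) = z * Gamma z.
Proof.
move=> z0; rewrite !GammaE [1 + z]addrC addrK.
have i1 : cintegrable (mellin_kernel 0 z) by apply: cintegrable_mellin0; lra.
have i2 : cintegrable (mellin_kernel 0 (z - 1)).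
  by apply: cintegrable_mellin0; rewrite ReD /=; lra.
have iZ1 := cintegrableZ (-1) i1; have iZ2 := cintegrableZ z i2.
have iW := cintegrableD iZ2 iZ1.
suff h : cint (fun t => z * mellin_kernel 0 (z - 1) t + -1 * mellin_kernel 0 z t) = 0.
  by move: h; rewrite cintD// !cintZ// mulN1r => /subr0_eq.
case: z z0 {i1 i2 iZ1 iZ2} iW => a b /= a0 iW.
(* The integrand is the derivative of [t^z e^-t], with real and imaginary parts: *)
pose U t := expR (a * ln t - t) * cos (b * ln t).
pose V t := expR (a * ln t - t) * sin (b * ln t).
pose U' t := expR (a * ln t - t) * ((a * t^-1 - 1) * cos (b * ln t) - b * t^-1 * sin (b * ln t)).
pose V' t := expR (a * ln t - t) * ((a * t^-1 - 1) * sin (b * ln t) + b * t^-1 * cos (b * ln t)).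
have WE t : 0 < t -> (a +i* b) * mellin_kernel 0 (a +i* b - 1) t +
    -1 * mellin_kernel 0 (a +i* b) t = U' t +i* V' t.
  move=> t0; rewrite /mellin_kernel !expr0 !mul1r mulrBl mul1r.
  have -> : (a +i* b) * (ln t)%:C - (ln t)%:C - t%:C =
      ((a +i* b) * (ln t)%:C - t%:C) + (- ln t)%:C by rewrite rmorphN addrAC.
  rewrite expCD expCR expRN expRln//.
  rewrite /expC Re_ln_sub Im_ln_sub /= /U' /V'.
  by apply/eqP; rewrite eq_complex /=; apply/andP; split; apply/eqP; ring.
have dU t : 0 < t -> is_derive t 1 U (U' t).
  move=> t0; have dln := is_derive1_ln t0; rewrite /U; apply: is_derive_eq.
  by rewrite /U' /GRing.scale /=; ring.
have dV t : 0 < t -> is_derive t 1 V (V' t).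
  move=> t0; have dln := is_derive1_ln t0; rewrite /V; apply: is_derive_eq.
  by rewrite /V' /GRing.scale /=; ring.
have dinv t : 0 < t -> is_derive t 1 (fun y : R => y^-1) (- t ^- 2 *: 1).
  by move=> t0; apply: is_deriveV; rewrite gt_eqF.
have cU t : 0 < t -> {for t, continuous U'}.
  move=> t0; have dln := is_derive1_ln t0; have dt := dinv t t0.
  by apply: continuous_of_is_derive; rewrite /U'; apply: is_derive_eq; reflexivity.
have cV t : 0 < t -> {for t, continuous V'}.
  move=> t0; have dln := is_derive1_ln t0; have dt := dinv t t0.
  by apply: continuous_of_is_derive; rewrite /V'; apply: is_derive_eq; reflexivity.
have sq (h : R -> R) : (forall x, `|h x| <= 1) -> forall u : nat -> R,
    expR (a * ln (u n) - u n) @[n --> \oo] --> (0 : R) ->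
    expR (a * ln (u n) - u n) * h (b * ln (u n)) @[n --> \oo] --> (0 : R).
  move=> h1 u /cvgrPdist_le u0; apply/cvgrPdist_le => e e0.
  have := u0 e e0; apply: filterS => n; rewrite !sub0r !normrN => /(le_trans _); apply.
  by rewrite normrM ler_piMr.
have u0 : expR (a * ln (n.+2%:R^-1) - n.+2%:R^-1) @[n --> \oo] --> (0 : R).
  apply: (@squeeze_cvgr _ _ _ _ (fun=> 0) (fun n => expR (a * ln (n.+2%:R^-1)))).
  - by apply: nearW => n; rewrite expR_ge0/= ler_expR gerBl invr_ge0.
  - exact: cvg_cst.
  - exact: cvg_gamma_boundary_0.
have u1 := cvg_gamma_boundary_y a0.
have [iU iV] := iW.
rewrite /cint; congr Complex.
- transitivity (\int[mu]_(t in D) U' t).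
    by apply: eq_Rintegral => t; rewrite inE => /posaxisE /WE ->.
  rewrite (Rintegral_posaxis dU cU _ (sq cos _ _ u0) (sq cos _ _ u1)) ?subrr//.
  + apply: eq_integrable iU => // t; rewrite inE => /posaxisE /WE.
    exact: (congr1 (fun w => (complex.Re w)%:E)).
  + exact: cos_max.
  + exact: cos_max.
- transitivity (\int[mu]_(t in D) V' t).
    by apply: eq_Rintegral => t; rewrite inE => /posaxisE /WE ->.
  rewrite (Rintegral_posaxis dV cV _ (sq sin _ _ u0) (sq sin _ _ u1)) ?subrr//.
  + apply: eq_integrable iV => // t; rewrite inE => /posaxisE /WE.
    exact: (congr1 (fun w => (complex.Im w)%:E)).
  + exact: sin_max.
  + exact: sin_max.
Qed.

Lemma Gamma1 : Gamma (1 : C) = 1.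
Proof.
pose F t := - expR (- t); pose f t := expR (- t).
have dF t : 0 < t -> is_derive t 1 F (f t).
  move=> t0; rewrite /F; apply: is_derive_eq; rewrite /f; ring.
have cf t : 0 < t -> {for t, continuous f}.
  by move=> t0; apply: continuous_of_is_derive; rewrite /f; apply: is_derive_eq; reflexivity.
have kE t : mellin_kernel 0 0 t = (f t)%:C.
  by rewrite /mellin_kernel expr0 mul1r mul0r sub0r -rmorphN expCR.
have [i1 _] : cintegrable (mellin_kernel 0 (0 : C)) by apply: cintegrable_mellin0 => /=; lra.
rewrite GammaE subrr /cint; congr Complex; last first.
  transitivity (\int[mu]_(t in D) (0 : R)); last by rewrite /Rintegral integral0.
  by apply: eq_Rintegral => t _; rewrite kE.
transitivity (\int[mu]_(t in D) f t).
  by apply: eq_Rintegral => t _; rewrite kE.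
have n0 : n.+2%:R^-1 @[n --> \oo] --> (0 : R).
  by have := @cvg_harmonic R; rewrite -cvg_shiftS.
have F0 : F (n.+2%:R^-1) @[n --> \oo] --> - (1 : R).
  have h : expR (- n.+2%:R^-1) @[n --> \oo] --> expR (- 0 : R).
    by apply: continuous_cvg; [exact: continuous_expR|exact: cvgN n0].
  by rewrite oppr0 expR0 in h; exact: cvgN h.
have Fy : F (n.+2%:R) @[n --> \oo] --> - (0 : R).
  apply: cvgN; have := @cvgn_expR R; rewrite -cvg_shiftS -cvg_shiftS; exact.
rewrite (Rintegral_posaxis dF cf _ F0 Fy) ?oppr0 ?sub0r ?opprK//.
apply: eq_integrable i1 => // t _.
exact: (congr1 (fun w => (complex.Re w)%:E) (kE t)).
Qed.

(** With u = |ln t|, the bound u^k <= 8^k k! e^(u/8) removes the power of the logarithm. Since 3/4 +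
    1/8 = 7/8, what remains is t^(7/8) e^-t for t >= 1 and t^(-7/8) e^-t for t < 1, that is,
    [gamma_weight] at 15/8 and 1/8. *)
Lemma mellin_kernel_dominated k : exists2 G : R -> R, mu.-integrable D (EFin \o G) &
  forall s t, `|s| <= 3 / 4 -> 0 < t -> `|ln t| ^+ k * expR (s * `|ln t| - t) <= G t.
Proof.
pose c := 8 ^+ k * k`!%:R : R.
have c0 : 0 <= c by rewrite mulr_ge0.
exists (fun t => c * (gamma_weight (1 / 8) t + gamma_weight (15 / 8) t)).
  have i1 : mu.-integrable D (EFin \o gamma_weight (1 / 8 : R))
    by apply: integrable_gamma_weight; lra.
  have i2 : mu.-integrable D (EFin \o gamma_weight (15 / 8 : R))
    by apply: integrable_gamma_weight; lra.
  apply: eq_integrable (integrableZl (@measurable_posaxis R) c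
    (integrableD (@measurable_posaxis R) i1 i2)); first exact: measurable_posaxis.
  by move=> t _; rewrite /= -EFinD -EFinM.
move=> s t s34 t0; set u := `|ln t|.
have u0 : 0 <= u := normr_ge0 _.
have h1 : u ^+ k <= c * expR (u / 8).
  rewrite {1}(_ : u = 8 * (u / 8)); last by field.
  rewrite exprMn /c -mulrA ler_wpM2l ?exprn_ge0//.
  have u80 : 0 <= u / 8 by lra.
  case: k {c c0} => [|k]; first by rewrite expr0 fact0 mul1r; have := expR_ge1Dx (u / 8); lra.
  rewrite [leRHS]mulrC -ler_pdivrMr ?ltr0n ?fact_gt0//.
  by apply: le_trans (expR_ge1Dxn k u80); lra.
have h2 : expR (u / 8) * expR (s * u - t) <= expR ((7 / 8) * u - t).
  rewrite -expRD ler_expR; have := ler_norm s => ?.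
  have : s * u <= 3 / 4 * u by rewrite ler_wpM2r//; lra.
  lra.
have h3 : expR ((7 / 8) * u - t) <= gamma_weight (1 / 8) t + gamma_weight (15 / 8) t.
  rewrite /gamma_weight /u; have [l0|l0] := leP 0 (ln t).
    apply: (@le_trans _ _ (expR ((15 / 8 - 1) * ln t - t))).
      by rewrite ler_expR (ger0_norm l0); lra.
    by rewrite lerDr expR_ge0.
  apply: (@le_trans _ _ (expR ((1 / 8 - 1) * ln t - t))).
    by rewrite ler_expR (ltr0_norm l0); lra.
  by rewrite lerDl expR_ge0.
apply: (@le_trans _ _ (c * expR (u / 8) * expR (s * u - t))).
  by rewrite ler_wpM2r ?expR_ge0.
rewrite -mulrA ler_wpM2l//; exact: le_trans h2 h3.
Qed.

Lemma mellin_kernel_expansion k p q t :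
  mellin_kernel k (p + q) t - mellin_kernel k p t - q * mellin_kernel k.+1 p t =
  mellin_kernel k p t * (expC (q * (ln t)%:C) - 1 - q * (ln t)%:C).
Proof.
rewrite mellin_kernelS /mellin_kernel.
have -> : (p + q) * (ln t)%:C - t%:C = (p * (ln t)%:C - t%:C) + q * (ln t)%:C by ring.
by rewrite expCD; ring.
Qed.

(** Differentiation under the integral sign: the derivative is the integral of the kernel of index k
    + 1, and the Taylor remainder is dominated by a kernel of index k + 2. The induction on [n]
    therefore needs all [k] at once. *)
Lemma smooth_mellin n k : exists B, smooth (1 / 4) n B (fun p => cint (mellin_kernel k p)).
Proof.
have ReB p t : complex.Re p * ln t <= cabs p * `|ln t|.
  by apply: le_trans (ler_norm _) _; rewrite normrM ler_wpM2r// ler_Re_cabs.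
have bound k' G : mu.-integrable D (EFin \o G) ->
    (forall s t, `|s| <= 3 / 4 -> 0 < t -> `|ln t| ^+ k' * expR (s * `|ln t| - t) <= G t) ->
    forall p t, cabs p < 1 / 4 -> 0 < t -> cabs (mellin_kernel k' p t) <= G t.
  move=> iG GP p t p4 t0; apply: le_trans (GP (cabs p) t _ t0).
    rewrite cabs_mellin_kernel ler_wpM2l ?exprn_ge0// ler_expR lerD2r//.
  by rewrite ger0_norm ?cabs_ge0//; lra.
have kint k' p : cabs p < 1 / 4 -> cintegrable (mellin_kernel k' p).
  move=> p4; have [G iG GP] := mellin_kernel_dominated k'.
  apply: (cintegrable_dominated (cmeasurable_mellin k' p) iG) => t; exact: bound.
elim: n k => [|n IH] k.
  have [G iG GP] := mellin_kernel_dominated k.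
  exists (2 * \int[mu]_(t in D) G t); split=> // p p4.
  by apply: cabs_cint_le => //; [exact: kint|move=> t; exact: bound].
have [B' sB'] := IH k.+1.
have [G iG GP] := mellin_kernel_dominated k.
have [G2 iG2 G2P] := mellin_kernel_dominated k.+2.
set b := 2 * \int[mu]_(t in D) G t.
set d := 2 * (4 * \int[mu]_(t in D) G2 t).
exists (`|b| + `|d| + `|B'|); split.
  move=> p p4; apply: (@le_trans _ _ b).
    by apply: cabs_cint_le => //; [exact: kint|move=> t; exact: bound].
  by have := ler_norm b; have := normr_ge0 d; have := normr_ge0 B'; lra.
exists (fun p => cint (mellin_kernel k.+1 p)); last first.
  apply: smoothW sB'; have := ler_norm B'; have := normr_ge0 d; have := normr_ge0 b; lra.
move=> p q p4 q4.
apply: (@le_trans _ _ (d * cabs q ^+ 2)); last first.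
  apply: ler_wpM2r; first by rewrite exprn_ge0 ?cabs_ge0.
  by have := ler_norm d; have := normr_ge0 b; have := normr_ge0 B'; lra.
have i1 := kint k _ q4; have i2 := cintegrableZ (-1) (kint k _ p4).
have i3 := cintegrableZ (- q) (kint k.+1 _ p4).
have -> : cint (mellin_kernel k (p + q)) - cint (mellin_kernel k p) -
    q * cint (mellin_kernel k.+1 p) =
    cint (fun t => mellin_kernel k (p + q) t + -1 * mellin_kernel k p t +
      - q * mellin_kernel k.+1 p t).
  rewrite cintD//; last exact: cintegrableD.
  by rewrite cintD// !cintZ ?mulN1r ?mulNr//; exact: kint.
have ic := cintegrableD (cintegrableD i1 i2) i3.
pose H t := 4 * cabs q ^+ 2 * G2 t.
have iH : mu.-integrable D (EFin \o H).
  apply: eq_integrable (integrableZl (@measurable_posaxis R) (4 * cabs q ^+ 2) iG2).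
    exact: measurable_posaxis.
  by move=> t _; rewrite /= EFinM.
apply: le_trans (cabs_cint_le ic iH _) _; last first.
  rewrite /H RintegralZl//.
  rewrite /d; move: (\int[mu]_(t in D) G2 t) (cabs q ^+ 2) => x y; lra.
move=> t t0.
rewrite mulN1r mulNr mellin_kernel_expansion cabsM.
apply: le_trans (ler_wpM2l (cabs_ge0 _) (expC_taylor1 _)) _.
rewrite cabs_mellin_kernel cabsM cabsR.
(* Since p and p + q have modulus below 1/4, |p| + |q| <= 3/4: the range for which
   [mellin_kernel_dominated] was stated. *)
have q2 : cabs q <= 1 / 2.
  have -> : q = (p + q) - p by ring.
  apply: le_trans (cabsB _ _) _; lra.
have h : expR (complex.Re p * ln t - t) * expR (cabs q * `|ln t|) <=
    expR ((cabs p + cabs q) * `|ln t| - t).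
  by rewrite -expRD ler_expR mulrDl; have := ReB p t; lra.
have s34 : `|cabs p + cabs q| <= 3 / 4.
  by rewrite ger0_norm ?addr_ge0 ?cabs_ge0//; lra.
have := G2P _ t s34 t0.
rewrite /H => h2.
set L := `|ln t| in h h2 *; set E1 := expR _ in h *; set E2 := expR (cabs q * L) in h *.
set E3 := expR _ in h h2.
have L0 : 0 <= L := normr_ge0 _.
rewrite (_ : L ^+ k * E1 * _ = cabs q ^+ 2 * (4 * (L ^+ k.+2 * (E1 * E2)))); last first.
  by rewrite exprMn !exprS; ring.
rewrite (_ : 4 * cabs q ^+ 2 * G2 t = cabs q ^+ 2 * (4 * G2 t)); last by ring.
apply: ler_wpM2l; first by rewrite exprn_ge0 ?cabs_ge0.
apply: ler_wpM2l => //; apply: le_trans h2; apply: ler_wpM2l h; exact: exprn_ge0.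
Qed.

End GammaFunction.

(** * The periods *)

Section HypergeometricCoefficients.
Variable R : realType.
Local Notation C := R[i].
Implicit Types (r B : R) (p q x : C).

Lemma smooth_shrink r r' k B (f : C -> C) : r' <= r -> smooth r k B f -> smooth r' k B f.
Proof.
move=> r'r; elim: k f => [|k IH] f /= [fB f1]; split=> //.
- by move=> p pr; apply: fB; exact: lt_le_trans r'r.
- by move=> p pr; apply: fB; exact: lt_le_trans r'r.
- move: f1 => [f' ff' /IH]; exists f' => // p q pr qr.
  by apply: ff'; [exact: lt_le_trans pr r'r|exact: lt_le_trans qr r'r].
Qed.

Definition gamma_ratio (n : nat) p : C :=
  Gamma (1 + 5 * (n%:R + p)) / Gamma (1 + (n%:R + p)) ^+ 5.

Lemma smooth_Gamma1D : exists B, smooth (1 / 4) 3 B (fun p : C => Gamma (1 + p)).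
Proof.
have [B sB] := smooth_mellin R 3 0; exists B.
by apply: smooth_ext sB => p _; rewrite GammaE [1 + p]addrC addrK.
Qed.

Lemma smooth_gamma_ratio0 : exists r B, [/\ 0 < r, r <= 1 / 20, smooth r 3 B (gamma_ratio 0) &
  forall p, cabs p < r -> Gamma (1 + p) != 0].
Proof.
have [B sB] := smooth_Gamma1D.
(* The term 20 keeps 5p in the disc of radius 1/4. The term 6|B| gives 3|B|r <= 1/2, so that the
   Lipschitz bound keeps Gamma(1 + p) within 1/2 of Gamma(1) = 1. *)
pose r := (20 + 6 * `|B|)^-1.
have d0 : 0 < 20 + 6 * `|B| by have := normr_ge0 B; lra.
have r0 : 0 < r by rewrite invr_gt0.
have rd : r * (20 + 6 * `|B|) = 1 by rewrite mulVf// gt_eqF.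
have r20 : r <= 1 / 20 by have := normr_ge0 B; nra.
have r1 : r <= 1 by lra.
have r4 : r <= 1 / 4 by lra.
have sBr := smooth_shrink r4 sB.
have lower p : cabs p < r -> 1 / 2 <= cabs (Gamma (1 + p)).
  move=> pr; have [fB [f' ff' sf']] := sBr.
  have := qdiff_lip r1 (smooth_bounded (k := 2) sf') ff' (p := 0) (q := p).
  rewrite !add0r cabs0 addr0 Gamma1 => /(_ r0 pr) h.
  have := cabs_lower 1 (Gamma (1 + p) - 1); rewrite cabs1 [1 + (_ - 1)]addrC subrK.
  have := ler_norm B; have := cabs_ge0 p; have := normr_ge0 B.
  move: (cabs (_ - _)) (cabs p) h pr (`|B|) rd => c a h pr b; nra.
have half0 : (0 : R) < 1 / 2 by lra.
have [BV sV] := smoothV 3 B r1 half0.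
have sGV := sV _ sBr lower.
have c5 : cabs (5 : C) = 5 by rewrite cabs_nat.
have s5 : smooth r 3 (5 ^+ 4 * B) (fun p => Gamma (1 + 5 * p)).
  rewrite -c5; apply: (@smooth_scale _ r 3 B (fun p : C => Gamma (1 + p)) 5).
    by rewrite c5 ler1n.
  by apply: smooth_shrink sB; rewrite c5; lra.
have sM := smoothM r1 s5 (smoothM r1 sGV (smoothM r1 sGV (smoothM r1 sGV (smoothM r1 sGV sGV)))).
exists r; eexists; split; [exact: r0|exact: r20| |].
  by apply: smooth_ext sM => p _; rewrite /gamma_ratio add0r -exprVn !exprS expr0 mulr1.
by move=> p /lower; rewrite -cabs_gt0; lra.
Qed.

Lemma Re_natD n p : complex.Re (n%:R + p) = n%:R + complex.Re p.
Proof. by rewrite ReD (_ : n%:R = (n%:R : R)%:C)// rmorph_nat. Qed.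

Lemma Re_natM n p : complex.Re (n%:R * p) = n%:R * complex.Re p.
Proof.
rewrite (_ : n%:R = (n%:R : R)%:C); last by rewrite rmorph_nat.
by rewrite mulrC ReMR mulrC.
Qed.

Lemma Re_gtN_cabs p r : cabs p < r -> - r < complex.Re p.
Proof.
by move=> pr; have := le_lt_trans (ler_Re_cabs p) pr; rewrite ltr_norml => /andP[].
Qed.

(* The factors of [gamma_ratio m / gamma_ratio m.-1], for [c < 5]. *)
Definition ratio_factor (c m : nat) p : C := 5 - c%:R / (m%:R + p).

Lemma natD_neq0 m p : cabs p < 1 -> (0 < m)%N -> m%:R + p != 0.
Proof.
move=> p1 m0; rewrite -cabs_gt0; apply: lt_le_trans (cabs_lower _ _).
by rewrite cabs_nat subr_gt0; apply: lt_le_trans p1 _; rewrite ler1n.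
Qed.

Lemma Gamma_natD_neq0 r n p : r <= 1 / 20 -> (forall p, cabs p < r -> Gamma (1 + p) != 0) ->
  cabs p < r -> Gamma (1 + (n%:R + p)) != 0.
Proof.
move=> r20 G0 pr; elim: n => [|n IH]; first by rewrite add0r G0.
have p20 : cabs p < 1 / 20 by lra.
have p1 : cabs p < 1 by lra.
rewrite Gamma_recursion; first by rewrite mulf_neq0 ?natD_neq0// -natr1 addrAC addrC.
rewrite Re_natD; have := Re_gtN_cabs p20; have : 0 <= n%:R :> R by []; lra.
Qed.

(** With N = n + p, the numerator gains (5N+5)(5N+4)(5N+3)(5N+2)(5N+1) and the denominator (N+1)^5;
    dividing 5N + 5 - c = 5(N+1) - c by N + 1 gives the factor of index c. *)
Lemma gamma_ratioS r n p : r <= 1 / 20 -> (forall p, cabs p < r -> Gamma (1 + p) != 0) ->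
  cabs p < r ->
  gamma_ratio n.+1 p = gamma_ratio n p *
    (ratio_factor 4 n.+1 p * (ratio_factor 3 n.+1 p * (ratio_factor 2 n.+1 p *
      (ratio_factor 1 n.+1 p * ratio_factor 0 n.+1 p)))).
Proof.
move=> r20 G0 pr.
have p20 : cabs p < 1 / 20 by lra.
have p1 : cabs p < 1 by lra.
have Rp := Re_gtN_cabs p20.
have n0 : 0 <= n%:R :> R by [].
have G1 := Gamma_natD_neq0 n r20 G0 pr.
have N1 : n%:R + p + 1 != 0 by rewrite addrAC natr1 natD_neq0.
rewrite /gamma_ratio /ratio_factor -[n.+1%:R]natr1 [n%:R + 1 + p]addrAC.
set N := n%:R + p in G1 N1 *.
(* This keeps 5N + j, for j >= 1, in the half-plane where the recursion of [Gamma] holds. *)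
have RN : - (1 / 20) < complex.Re N by rewrite Re_natD; lra.
have step j : (0 < j)%N -> Gamma (1 + (5 * N + j%:R)) = (5 * N + j%:R) * Gamma (5 * N + j%:R).
  move=> j0; apply: Gamma_recursion; rewrite addrC Re_natD Re_natM.
  have : 1 <= j%:R :> R by rewrite ler1n.
  lra.
have -> : Gamma (1 + 5 * (N + 1)) = (5 * N + 5) * (5 * N + 4) * (5 * N + 3) * (5 * N + 2) *
    (5 * N + 1) * Gamma (1 + 5 * N).
  have sh j : 5 * N + j.+1%:R = 1 + (5 * N + j%:R) by rewrite -[j.+1%:R]natr1; ring.
  have -> : 1 + 5 * (N + 1) = 1 + (5 * N + 5%:R) by ring.
  rewrite step// (sh 4%N) step// (sh 3%N) step// (sh 2%N) step// (sh 1%N) step//.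
  by rewrite [5 * N + 1%:R]addrC; ring.
have -> : Gamma (1 + (N + 1)) = (N + 1) * Gamma (1 + N).
  by rewrite [N + 1]addrC Gamma_recursion// ReD /=; lra.
by field; rewrite N1 G1.
Qed.

(** Writing c/(m+p) as (c/m) (1 + p/m)^-1 makes the bound uniform in [m]: the coefficient 1/m is at
    most 1, and |1 + p/m| stays above 1/2. *)
Lemma smooth_ratio_factor r c k : r <= 1 / 20 -> exists B, forall m, (0 < m)%N ->
  smooth r k B (ratio_factor c m).
Proof.
move=> r20; have r1 : r <= 1 by lra.
have half0 : (0 : R) < 1 / 2 by lra.
have [BV sV] := smoothV k 2 r1 half0.
exists (cabs (5 : C) + cabs (- c%:R : C) * `|BV|) => m m0.
have m1 : 1 <= m%:R :> R by rewrite ler1n.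
have mC : m%:R != 0 :> C by rewrite pnatr_eq0 -lt0n.
have mV : cabs (m%:R^-1 : C) <= 1 by rewrite cabsV cabs_nat invf_le1// ltr0n.
have s1 : smooth r k 2 (fun p => 1 + m%:R^-1 * p).
  by apply: smoothW (smooth_affine k 1 _ r1); rewrite cabs1; lra.
have s2 := sV _ s1.
have {}s2 : smooth r k BV (fun p => (1 + m%:R^-1 * p)^-1).
  apply: s2 => p pr; have := cabs_lower 1 (m%:R^-1 * p); rewrite cabs1 cabsM.
  have : cabs (m%:R^-1 : C) * cabs p <= cabs p by rewrite ler_piMl// cabs_ge0.
  lra.
have s3 := smoothZ (- c%:R) (smoothZ m%:R^-1 s2).
have s4 := smoothD (smooth_cst r k (5 : C)) s3.
apply: (smooth_ext (f := fun p => 5 + - c%:R * (m%:R^-1 * (1 + m%:R^-1 * p)^-1))).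
  move=> p pr; rewrite /ratio_factor; have p1 : cabs p < 1 by lra.
  have := natD_neq0 p1 m0 => mp.
  have mp' : 1 + m%:R^-1 * p != 0.
    have -> : 1 + m%:R^-1 * p = m%:R^-1 * (m%:R + p) by rewrite mulrDr mulVf.
    by rewrite mulf_neq0// invr_eq0.
  by field; rewrite mp mC.
apply: smoothW s4; rewrite lerD2l ler_wpM2l ?cabs_ge0//.
apply: le_trans (ler_norm _) _; rewrite normrM ler_piMl//.
by rewrite ger0_norm ?cabs_ge0.
Qed.

Lemma smooth_gamma_ratio : exists r A Q, [/\ 0 < r <= 1, 0 <= A, 0 <= Q &
  forall n, smooth r 3 (A * Q ^+ n) (gamma_ratio n)].
Proof.
have [r [A [r0 r20 sA G0]]] := smooth_gamma_ratio0.
have r1 : r <= 1 by lra.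
have [B0 s0] := smooth_ratio_factor 0 3 r20.
have [B1 s1] := smooth_ratio_factor 1 3 r20.
have [B2 s2] := smooth_ratio_factor 2 3 r20.
have [B3 s3] := smooth_ratio_factor 3 3 r20.
have [B4 s4] := smooth_ratio_factor 4 3 r20.
have [K sK] : exists K, forall m, (0 < m)%N -> smooth r 3 K (fun p =>
    ratio_factor 4 m p * (ratio_factor 3 m p * (ratio_factor 2 m p *
      (ratio_factor 1 m p * ratio_factor 0 m p)))).
  eexists => m m0; apply: (smoothM r1 (s4 m m0)); apply: (smoothM r1 (s3 m m0)).
  by apply: (smoothM r1 (s2 m m0)); apply: (smoothM r1 (s1 m m0)); exact: s0.
exists r, `|A|, `|2 ^+ 3 * 5 * K|; split=> //; first by rewrite r0.
elim=> [|n IH]; first by rewrite expr0 mulr1; apply: smoothW sA; exact: ler_norm.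
apply: (smooth_ext (f := fun p => gamma_ratio n p *
    (ratio_factor 4 n.+1 p * (ratio_factor 3 n.+1 p * (ratio_factor 2 n.+1 p *
      (ratio_factor 1 n.+1 p * ratio_factor 0 n.+1 p)))))).
  by move=> p pr; rewrite (gamma_ratioS n r20 G0 pr).
apply: smoothW (smoothM r1 IH (sK n.+1 isT)).
set q := 2 ^+ 3 * 5 * K.
have -> : 2 ^+ 3 * 5 * (`|A| * `|q| ^+ n * K) = `|A| * `|q| ^+ n * q by rewrite /q; ring.
rewrite exprSr mulrA; apply: ler_wpM2l (ler_norm _).
by apply: mulr_ge0 => //; exact: exprn_ge0.
Qed.

Lemma gamma_ratio00 : gamma_ratio 0 0 = 1.
Proof. by rewrite /gamma_ratio !addr0 mulr0 addr0 Gamma1 expr1n divr1. Qed.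

End HypergeometricCoefficients.

(** * Expansion of the periods in powers of log x *)

Section Periods.
Variable R : realType.
Local Notation C := R[i].
Implicit Types (r B : R) (p q x L : C).

Lemma is_qdiff_expC r L : r <= 1 ->
  is_qdiff r (fun p => expC (p * L)) (fun p => L * expC (p * L)).
Proof.
move=> r1; pose l := cabs L; have l0 : 0 <= l := cabs_ge0 L.
have eb p : cabs p < r -> cabs (expC (p * L)) <= expR l.
  move=> pr; rewrite cabs_expC ler_expR.
  apply: le_trans (ler_norm _) _; apply: le_trans (ler_Re_cabs _) _.
  by rewrite cabsM ler_piMl//; lra.
have E0 := expR_gt0 l; have E20 := expR_gt0 (2 * l).
exists (expR l + l * expR l + expR l * (4 * l ^+ 2 * expR (2 * l))).
have c0 : 0 <= expR l * (4 * l ^+ 2 * expR (2 * l)).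
  by rewrite !mulr_ge0 ?expR_ge0// exprn_ge0.
have d0 : 0 <= l * expR l by rewrite mulr_ge0 ?expR_ge0.
split.
- by move=> p pr; have := eb p pr; lra.
- move=> p pr; rewrite cabsM; have := ler_wpM2l l0 (eb p pr); rewrite -/l; lra.
move=> p q pr qr.
have q2 : cabs q <= 2.
  have -> : q = (p + q) - p by ring.
  apply: le_trans (cabsB _ _) _; lra.
have -> : expC ((p + q) * L) - expC (p * L) - q * (L * expC (p * L)) =
    expC (p * L) * (expC (q * L) - 1 - q * L) by rewrite mulrDl expCD; ring.
rewrite cabsM.
apply: le_trans (ler_wpM2l (cabs_ge0 _) (expC_taylor1 _)) _.
rewrite cabsM -/l.
have e1 : expR (cabs q * l) <= expR (2 * l) by rewrite ler_expR ler_wpM2r.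
have q0 : 0 <= cabs q ^+ 2 by rewrite exprn_ge0 ?cabs_ge0.
apply: (@le_trans _ _ (expR l * (4 * (cabs q * l) ^+ 2 * expR (2 * l)))).
  apply: ler_pM => //; rewrite ?cabs_ge0 ?mulr_ge0 ?exprn_ge0 ?expR_ge0 ?mulr_ge0 ?cabs_ge0//.
    exact: eb.
  by rewrite ler_wpM2l// mulr_ge0// exprn_ge0// mulr_ge0// cabs_ge0.
have -> : expR l * (4 * (cabs q * l) ^+ 2 * expR (2 * l)) =
   expR l * (4 * l ^+ 2 * expR (2 * l)) * cabs q ^+ 2 by rewrite exprMn; ring.
by apply: ler_wpM2r => //; lra.
Qed.

(** [G1], [G2], [G3] are the derivatives of [G] at 0, so their bound [B] does not involve [L], which
    enters only through explicit powers. *)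
Lemma derive1n_expC_mul r B L (F G : C -> C) : 0 < r <= 1 -> smooth r 3 B G ->
  (forall p, cabs p < r -> F p = expC (p * L) * G p) ->
  exists G1 G2 G3 : C, [/\ cabs G1 <= B, cabs G2 <= B, cabs G3 <= B &
    [/\ F 0 = G 0, derive1n 1 F 0 = L * G 0 + G1,
      derive1n 2 F 0 = L ^+ 2 * G 0 + 2 * L * G1 + G2 &
      derive1n 3 F 0 = L ^+ 3 * G 0 + 3 * L ^+ 2 * G1 + 3 * L * G2 + G3]].
Proof.
move=> /andP[r0 r1] sG FG.
have [G1 d0 sG1] := smooth_is_qdiff (k := 2) sG.
have [G2 d1 sG2] := smooth_is_qdiff (k := 1) sG1.
have [G3 d2 sG3] := smooth_is_qdiff (k := 0) sG2.
have dE := is_qdiff_expC L r1.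
have z0 : cabs (0 : C) < r by rewrite cabs0.
pose E p := expC (p * L).
have E0 : E 0 = 1 by rewrite /E mul0r expC0.
have cM c f f' : is_qdiff r f f' -> is_qdiff r (fun p => c * f p) (fun p => c * f' p).
  move=> ff'; have := is_qdiffM r1 (is_qdiff_cst r c) ff'.
  by under [X in is_qdiff _ _ X]eq_fun do rewrite mul0r add0r.
(* The entries are E times (L + d/dp)^j applied to G. *)
pose h (j : nat) p : C := nth 0 [:: E p * G p; E p * (L * G p + G1 p);
  E p * (L ^+ 2 * G p + 2 * L * G1 p + G2 p);
  E p * (L ^+ 3 * G p + 3 * L ^+ 2 * G1 p + 3 * L * G2 p + G3 p)] j.
have EM f f' : is_qdiff r f f' -> is_qdiff r (fun p => E p * f p) (fun p => E p * (L * f p + f' p)).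
  move=> ff'; have := is_qdiffM r1 dE ff'; congr (is_qdiff _ _ _).
  by apply/funext => p; rewrite /E; ring.
have hh j : (j < 3)%N -> is_qdiff r (h j) (h j.+1).
  case: j => [|[|[|//]]] _; rewrite /h /=.
  - exact: EM.
  - have := EM _ _ (is_qdiffD (cM L _ _ d0) d1); congr (is_qdiff _ _ _).
    by apply/funext => p; ring.
  - have := EM _ _ (is_qdiffD (is_qdiffD (cM (L ^+ 2) _ _ d0) (cM (2 * L) _ _ d1)) d2).
    congr (is_qdiff _ _ _); by apply/funext => p; ring.
have Fh p : cabs p < r -> F p = h 0%N p by move=> /FG.
have D n : (n <= 3)%N -> derive1n n F 0 = h n 0.
  move=> n3; apply: (derive1n_qdiff Fh) z0 => j jn; apply: hh; exact: leq_trans jn n3.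
exists (G1 0), (G2 0), (G3 0); split.
- exact: (smooth_bounded (k := 2) sG1).
- exact: (smooth_bounded (k := 1) sG2).
- exact: (smooth_bounded (k := 0) sG3).
by split; rewrite ?D// ?Fh// /h /= E0 mul1r.
Qed.

(* [g0] is the holomorphic period; it stays away from 0 and the [gi] stay bounded
   near [x = 0], uniformly in the branch [L] of the logarithm. *)
Lemma period_expansion : exists r B : R, 0 < r /\ forall x, cabs x < r ->
  forall lg : C -> C, expC (lg x) = x -> exists g0 g1 g2 g3 : C,
  [/\ 1 / 2 <= cabs g0, [/\ cabs g0 <= B, cabs g1 <= B, cabs g2 <= B & cabs g3 <= B] &
  [/\ w lg x 0 = g0, w_ lg 1 x = lg x * g0 + g1,
      w_ lg 2 x = lg x ^+ 2 * g0 + 2 * lg x * g1 + g2 &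
      w_ lg 3 x = lg x ^+ 3 * g0 + 3 * lg x ^+ 2 * g1 + 3 * lg x * g2 + g3]].
Proof.
have [r [A [Q [r01 A0 Q0 sa]]]] := smooth_gamma_ratio R.
have d0 : 0 < 2 * Q + 8 * (A * Q) + 1.
  by have : 0 <= A * Q by [exact: mulr_ge0]; lra.
(* With z = Q|x|, the summand 2Q gives z <= 1/2, so the dominating series sums to at most 2A. The
   summand 8AQ gives 8Az <= 1, so the terms n >= 1 of the holomorphic period add up to at most 4Az
   <= 1/2. The 1 makes the radius meaningful when Q = 0. *)
exists (2 * Q + 8 * (A * Q) + 1)^-1, (2 * A); split; first by rewrite invr_gt0.
move=> x xr lg lgx.
have AQ0 : 0 <= A * Q by exact: mulr_ge0.
have xd : cabs x * (2 * Q + 8 * (A * Q) + 1) < 1 by rewrite -ltr_pdivlMr// div1r.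
have x0 := cabs_ge0 x.
pose z := Q * cabs x.
have z0 : 0 <= z by exact: mulr_ge0.
have z2 : z <= 1 / 2 by have : 0 <= A * Q * cabs x by [exact: mulr_ge0]; rewrite /z; nra.
have z8 : 8 * A * z <= 1 by rewrite /z; nra.
have B0 n : 0 <= A * z ^+ n by rewrite mulr_ge0 ?exprn_ge0.
have z1 : `|z| < 1 by rewrite ger0_norm//; lra.
have cB : cvgn (series (fun n => A * z ^+ n)) := @is_cvg_geometric_series _ A z z1.
have limB : limn (series (fun n => A * z ^+ n)) <= 2 * A.
  rewrite (cvg_lim (@norm_hausdorff _ _) (@cvg_geometric_series _ A z z1)).
  by rewrite ler_pdivrMr; [nra|lra].
have sf n : smooth r 3 (A * z ^+ n) (fun p => x ^+ n * gamma_ratio n p).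
  rewrite /z exprMn mulrA mulrC -cabsX; exact: smoothZ.
have /choice[G GP] : forall p, exists l, cabs p < r ->
    sums_to (fun n => x ^+ n * gamma_ratio n p) l.
  move=> p; have [pr|pr] := boolP (cabs p < r); last by exists 0.
  have [n|l lP] := sums_to_dominated _ cB (u := fun n => x ^+ n * gamma_ratio n p).
    exact: (smooth_bounded (sf n)).
  by exists l.
have [r0 r1] := andP r01.
have zr : cabs (0 : C) < r by rewrite cabs0.
have sG : smooth r 3 (2 * A) G.
  by apply: smoothW limB _; apply: smooth_series cB sf GP.
(* The integer power of x does not depend on the branch, so the logarithm survives only in the
   exponential factor. *)
have wE p : cabs p < r -> w lg x p = expC (p * lg x) * G p.
  move=> pr; rewrite -(sums_to_lim (sums_toZ (expC (p * lg x)) (GP p pr))) /w.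
  congr (limn (series _)); apply/funext => n.
  have -> : (n%:R + p) * lg x = n%:R * lg x + p * lg x by rewrite mulrDl.
  by rewrite expCD expC_natM lgx /gamma_ratio; ring.
have [g1 [g2 [g3 [b1 b2 b3 [w0 w1 w2 w3]]]]] := derive1n_expC_mul r01 sG wE.
exists (G 0), g1, g2, g3; split => //; last first.
  by split=> //; exact: (smooth_bounded (k := 3) sG).
have h2 : `|1 / 2 : R| < 1 by rewrite ger0_norm; lra.
have cH := @is_cvg_geometric_series R 1 (1 / 2) h2.
(* The term n = 0 equals 1 and is removed. The others satisfy z^(n+1) <= 2z (1/2)^(n+1), where the 2
   makes up for the index shift. *)
have := sums_toD (GP 0 zr) (sums_toZ (-1) (sums_to_const (1 : C))).
have Az0 : 0 <= 2 * A * z by rewrite !mulr_ge0.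
move=> /sums_to_le => /(_ (fun n => 1 * (1 / 2) ^+ n) (2 * A * z) Az0) h.
have {}h : cabs (G 0 + -1 * 1) <= 2 * A * z * (1 / (1 - 1 / 2)).
  rewrite -(cvg_lim (@norm_hausdorff _ _) (@cvg_geometric_series R 1 (1 / 2) h2)).
  apply: h => [n||[|n]]; first by rewrite mul1r exprn_ge0.
  - exact: cH.
  - by rewrite /= !expr0 !mul1r gamma_ratio00 mulN1r subrr cabs0 mulr1.
  - rewrite /= mulr0 addr0; apply: le_trans (smooth_bounded (sf n.+1) zr) _.
    rewrite mul1r !exprS.
    have : z ^+ n <= (1 / 2) ^+ n by rewrite lerXn2r ?nnegrE.
    have : 0 <= A * z by rewrite mulr_ge0.
    by move: (z ^+ n) ((1 / 2) ^+ n) => u v; nra.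
have := cabs_lower 1 (G 0 + -1 * 1); rewrite cabs1.
have -> : 1 + (G 0 + -1 * 1) = G 0 by ring.
have e2 : 1 / (1 - 1 / 2) = 2 :> R by field.
by rewrite e2 in h; lra.
Qed.

End Periods.

(** * The charges *)

Section Monodromy.
Variable R : realType.
Local Notation C := R[i].
Variable lg : C -> C.

(* The last rows of [M_infty ^+ k]. *)
Definition charge_table : seq (seq int) :=
  [:: [:: 0; 0; 0; 1]; [:: 5; -8; 1; -4]; [:: -10; 19; -3; 6];
      [:: 10; -14; 3; -4]; [:: -5; 3; -1; 1]].

Definition charge_coef (k j : nat) : int := nth 0 (nth [::] charge_table k) j.

Definition charge_row (k : nat) : 'rV[C]_4 := \row_j (charge_coef k j)%:~R.

Lemma charge_row_mul k : (k < 5)%N ->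
  charge_row k *m M_infty R = charge_row (if k == 4 then 0 else k.+1).
Proof.
move=> k5; apply/rowP => j; rewrite !mxE !big_ord_recl big_ord0 addr0 !mxE /=.
rewrite -!intrM -!intrD; congr (_%:~R).
by case: k k5 => [|[|[|[|[|//]]]]] _; case: j => [[|[|[|[|//]]]] ?].
Qed.

(** Only the orbit of the last row under right multiplication is followed; it closes after five
    steps. *)
Lemma row_M_infty n : row (inord 3) (M_infty R ^+ n) = charge_row (n %% 5).
Proof.
elim: n => [|n IH].
  rewrite expr0; apply/rowP => j; rewrite !mxE /charge_coef.
  have -> : (inord 3 == j :> 'I_4) = (j == 3 :> nat) by rewrite eq_sym -val_eqE /= inordK.
  by case: j => [[|[|[|[|//]]]] ?].
rewrite exprSr -[_ * _]/(_ *m _) row_mul IH charge_row_mul ?ltn_mod//.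
congr charge_row; rewrite -[n.+1]addn1 -modnDml addn1.
have : (n %% 5 < 5)%N by rewrite ltn_mod.
by case: (n %% 5)%N => [|[|[|[|[|]]]]].
Qed.

Definition charge (k : nat) (x : C) : C :=
  \sum_(j < 4) (charge_coef k j)%:~R * PiB lg x j 0 + component (PiB lg x) 2 / 5.

Lemma Z_simpleE x s : Z_simple lg x s = charge ((\sum_i s i) %% 5) x.
Proof.
rewrite /Z_simple /charge; congr (_ + _); rewrite /component.
have -> : (M_infty R ^+ (\sum_i s i)%N *m PiB lg x) (inord 3) 0 =
    (row (inord 3) (M_infty R ^+ (\sum_i s i)%N) *m PiB lg x) 0 0.
  by rewrite -row_mul [RHS]mxE.
by rewrite row_M_infty mxE; apply: eq_bigr => j _; rewrite mxE.
Qed.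

Lemma sum_charge x : \sum_(k < 5) charge k x = component (PiB lg x) 2.
Proof.
rewrite big_split /= sumr_const card_ord exchange_big big1 ?add0r /=; last first.
  move=> j _; rewrite -mulr_suml -rmorph_sum /= (_ : \sum_(k < 5) _ = 0) ?mul0r//.
  by rewrite !big_ord_recl big_ord0; case: j => [[|[|[|[|//]]]] ?].
by rewrite -[LHS]mulr_natr divfK// pnatr_eq0.
Qed.

(** The last column 1, -4, 6, -4, 1 has only the coincidences 0 with 4 and 1 with 3; there the
    preceding column has 0 against -1 and 1 against 3. A difference of charges thus has degree 3 or
    2 in log x. *)
Lemma charge_coef_neq k l : (k < 5)%N -> (l < 5)%N -> k != l ->
  charge_coef k 3 != charge_coef l 3 \/
  charge_coef k 3 = charge_coef l 3 /\ charge_coef k 2 != charge_coef l 2.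
Proof.
by case: k => [|[|[|[|[|//]]]]] _; case: l => [|[|[|[|[|//]]]]] _ // _;
  first [by left | by right].
Qed.

(** Coordinates are at most 3, so the value 4 needs a second one: [minn k 3] and the truncated
    difference [k - 3]. *)
Lemma sum_vertex k : (k < 5)%N -> exists s : vertex, (\sum_i s i)%N = k.
Proof.
move=> k5.
exists [ffun i : 'I_5 => inord (if i == 0 :> nat then minn k 3 else
  if i == 1 :> nat then k - 3 else 0)%N].
rewrite !big_ord_recl big_ord0 !ffunE /= !inordK//.
- by case: k k5 => [|[|[|[|[|]]]]].
- by case: k k5 => [|[|[|[|[|]]]]].
- by case: k k5 => [|[|[|[|[|]]]]].
Qed.

End Monodromy.

(** * Dominance of the leading power of a large logarithm *)

Section LargeLogarithm.
Variable R : realType.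
Local Notation C := R[i].
Implicit Types (L : C).

(** The threshold is chosen so that c|L| > 3d + c; then the cubic term exceeds 3d|L|^2, which bounds
    the three lower terms together because |L| >= 1. *)
Lemma cubic_neq0 (c d : R) : 0 < c -> exists l : R, forall L (c0 c1 c2 c3 : C),
  l < cabs L -> c <= cabs c3 -> cabs c0 <= d -> cabs c1 <= d -> cabs c2 <= d ->
  c3 * L ^+ 3 + c2 * L ^+ 2 + c1 * L + c0 != 0.
Proof.
move=> c_gt0; exists (1 + 3 * `|d| / c) => L c0 c1 c2 c3 lL cc3 h0 h1 h2; apply/eqP => e.
have d0 : 0 <= d by apply: le_trans h0; exact: cabs_ge0.
have e3 : c3 * L ^+ 3 = - (c2 * L ^+ 2 + c1 * L + c0).
  by apply/eqP; rewrite -subr_eq0 opprK !addrA e.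
have : cabs (c3 * L ^+ 3) <= d * cabs L ^+ 2 + d * cabs L + d.
  rewrite e3 cabsN; apply: le_trans (cabsD _ _) (lerD _ h0).
  apply: le_trans (cabsD _ _) (lerD _ _); rewrite cabsM ?cabsX ler_wpM2r//.
    by rewrite exprn_ge0// cabs_ge0.
  exact: cabs_ge0.
rewrite cabsM cabsX ger0_norm// in lL *.
have q0 : 0 <= 3 * d / c by rewrite divr_ge0 ?mulr_ge0// ltW.
have cq : c * (3 * d / c) = 3 * d by rewrite mulrC divfK// gt_eqF.
move: (cabs L) lL (cabs c3) cc3 => l lL a ca.
have l1 : 1 <= l by lra.
have cl : 3 * d + c < c * l.
  by rewrite -cq -[X in _ + X < _]mulr1 -mulrDr ltr_pM2l//; lra.
have l2 : 0 < l ^+ 2 by rewrite exprn_gt0//; lra.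
have : c * l ^+ 3 <= a * l ^+ 3 by rewrite ler_wpM2r// exprn_ge0//; lra.
have : (3 * d + c) * l ^+ 2 < c * l * l ^+ 2 by rewrite ltr_pM2r.
have : d * l <= d * l ^+ 2 by rewrite ler_wpM2l// expr2 ler_peMl//; lra.
have : d <= d * l by rewrite ler_peMr.
have : 0 < c * l ^+ 2 by rewrite mulr_gt0.
rewrite (exprS l 2); move: (l ^+ 2) => y; lra.
Qed.

(* With [L = log x], the combined terms are the periods [w_k] as in
   [period_expansion]. *)
Lemma period_combination_neq0 (b0 b1 b2 b3 : C) (B : R) :
  b3 != 0 \/ b3 = 0 /\ b2 != 0 ->
  exists l : R, forall L (g0 g1 g2 g3 : C), l < cabs L -> 1 / 2 <= cabs g0 ->
  cabs g0 <= B -> cabs g1 <= B -> cabs g2 <= B -> cabs g3 <= B ->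
  b0 * g0 + b1 * (L * g0 + g1) + b2 * (L ^+ 2 * g0 + 2 * L * g1 + g2) +
  b3 * (L ^+ 3 * g0 + 3 * L ^+ 2 * g1 + 3 * L * g2 + g3) != 0.
Proof.
(* The factors 1, 1, 2, 3 are the largest with which the b_j occur in a lower coefficient, so one
   [d] serves for all of them. *)
pose d := (cabs b0 + cabs b1 + 2 * cabs b2 + 3 * cabs b3) * B.
have n2 : cabs (2 : C) = 2 by rewrite cabs_nat.
have n3 : cabs (3 : C) = 3 by rewrite cabs_nat.
have tri (a0 a1 a2 a3 g0 g1 g2 g3 : C) : cabs g0 <= B -> cabs g1 <= B -> cabs g2 <= B ->
    cabs g3 <= B -> cabs (a0 * g0 + a1 * g1 + a2 * g2 + a3 * g3) <=
    (cabs a0 + cabs a1 + cabs a2 + cabs a3) * B.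
  move=> h0 h1 h2 h3; rewrite !mulrDl.
  apply: le_trans (cabsD _ _) (lerD (le_trans (cabsD _ _)
    (lerD (le_trans (cabsD _ _) (lerD _ _)) _)) _); by rewrite cabsM ler_wpM2l ?cabs_ge0.
have dW (a : R) g0 : cabs g0 <= B -> a <= cabs b0 + cabs b1 + 2 * cabs b2 + 3 * cabs b3 ->
    a * B <= d.
  by move=> gB; apply: ler_wpM2r; apply: le_trans gB; exact: cabs_ge0.
have p0 := cabs_ge0 b0; have p1 := cabs_ge0 b1.
have p2 := cabs_ge0 b2; have p3 := cabs_ge0 b3.
case=> [b3n|[b3z b2n]].
  have c0 : 0 < cabs b3 / 2 by rewrite divr_gt0 ?cabs_gt0.
  have [l lP] := cubic_neq0 d c0; exists l => L g0 g1 g2 g3 lL g0l h0 h1 h2 h3.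
  have -> : b0 * g0 + b1 * (L * g0 + g1) + b2 * (L ^+ 2 * g0 + 2 * L * g1 + g2) +
    b3 * (L ^+ 3 * g0 + 3 * L ^+ 2 * g1 + 3 * L * g2 + g3) =
    b3 * g0 * L ^+ 3 + (b2 * g0 + 3 * b3 * g1 + 0 * g2 + 0 * g3) * L ^+ 2 +
    (b1 * g0 + 2 * b2 * g1 + 3 * b3 * g2 + 0 * g3) * L +
    (b0 * g0 + b1 * g1 + b2 * g2 + b3 * g3) by ring.
  apply: lP => //.
  - by rewrite cabsM; nra.
  - by apply: le_trans (tri _ _ _ _ _ _ _ _ h0 h1 h2 h3) (dW _ _ h0 _); lra.
  - by apply: le_trans (tri _ _ _ _ _ _ _ _ h0 h1 h2 h3) (dW _ _ h0 _);
      rewrite !cabsM n2 n3 cabs0; lra.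
  - by apply: le_trans (tri _ _ _ _ _ _ _ _ h0 h1 h2 h3) (dW _ _ h0 _);
      rewrite !cabsM n3 cabs0; lra.
have c0 : 0 < cabs b2 / 2 by rewrite divr_gt0 ?cabs_gt0.
have [l lP] := cubic_neq0 d c0; exists l => L g0 g1 g2 g3 lL g0l h0 h1 h2 h3.
(* The quadratic case is multiplied by [L] to become a cubic with constant term 0. *)
have : (b2 * g0) * L ^+ 3 + (b1 * g0 + 2 * b2 * g1 + 0 * g2 + 0 * g3) * L ^+ 2 +
    (b0 * g0 + b1 * g1 + b2 * g2 + 0 * g3) * L + 0 != 0.
  have B0 : 0 <= B by apply: le_trans h0; exact: cabs_ge0.
  apply: lP => //.
  - by rewrite cabsM; nra.
  - by rewrite cabs0 mulr_ge0 ?addr_ge0 ?mulr_ge0.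
  - by apply: le_trans (tri _ _ _ _ _ _ _ _ h0 h1 h2 h3) (dW _ _ h0 _);
      rewrite ?cabs0; lra.
  - by apply: le_trans (tri _ _ _ _ _ _ _ _ h0 h1 h2 h3) (dW _ _ h0 _);
      rewrite !cabsM n2 cabs0; lra.
apply: contra_neq => e; rewrite b3z mul0r addr0 in e.
transitivity ((b0 * g0 + b1 * (L * g0 + g1) +
  b2 * (L ^+ 2 * g0 + 2 * L * g1 + g2)) * L); [by ring|by rewrite e mul0r].
Qed.

Lemma twopii_neq0 : twopii R != 0.
Proof.
rewrite /twopii !mulf_neq0//.
  by rewrite -cabs_gt0 cabsR normr_gt0 gt_eqF// pi_gt0.
by rewrite -cabs_gt0 cabsE /= expr0n add0r expr1n sqrtr1.
Qed.

End LargeLogarithm.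

(** * Separation of the charges and summation over the stable objects *)

Section Main.
Variable R : realType.
Local Notation C := R[i].

Lemma iso_dim (V W : rep C) s : iso V W -> Defs.dim V s = Defs.dim W s.
Proof.
move=> [f [g fg]]; have [h1 h2] := fg s.
by apply/eqP; rewrite eqn_leq (mulmx1_min h1) (mulmx1_min h2).
Qed.

Lemma iso_refl (V : rep C) : iso V V.
Proof.
have c s t (st : arrow s t) : rep_map V st *m 1%:M = 1%:M *m rep_map V st.
  by rewrite mulmx1 mul1mx.
by exists (Defs.Hom c), (Defs.Hom c) => s; rewrite /= mulmx1.
Qed.

Lemma Z'_iso lg x (V W : rep C) : iso V W -> Z' lg x V = Z' lg x W.
Proof. by move=> VW; apply: eq_bigr => s _; rewrite (iso_dim s VW). Qed.

(** The radius [e] precedes [lg], because the estimates see the branch only through |log x|. *)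
Lemma charge_inj (k l : nat) : (k < 5)%N -> (l < 5)%N -> k != l ->
  exists2 e : R, 0 < e & forall (lg : C -> C) x, 0 < cabs x < e -> expC (lg x) = x ->
    charge lg k x != charge lg l x.
Proof.
move=> k5 l5 kl.
have [r [B [r0 periods]]] := period_expansion R.
have T0 := twopii_neq0 R; set T := twopii R in T0.
pose a j : C := (charge_coef k j - charge_coef l j)%:~R.
(* The difference of the charges is regrouped by w_0, ..., w_3: [b1] collects the w_1 terms of the
   last three components of [PiB]. The common summand, one fifth of the second component,
   cancels. *)
pose b1 := a 1%N / T + a 2%N * (11 / 2) / T - a 3%N * (50 / 12) / T.
pose b2 := a 2%N * 5 / (2 * T ^+ 2).
pose b3 := - (a 3%N * 5 / (6 * T ^+ 3)).
have bn : b3 != 0 \/ b3 = 0 /\ b2 != 0.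
  have an j : charge_coef k j != charge_coef l j -> a j != 0.
    by move=> c; rewrite /a intr_eq0 subr_eq0.
  have n5 : (5 : C) != 0 by rewrite pnatr_eq0.
  have d2 : 2 * T ^+ 2 != 0 by rewrite mulf_neq0 ?expf_neq0 ?pnatr_eq0.
  have d3 : 6 * T ^+ 3 != 0 by rewrite mulf_neq0 ?expf_neq0 ?pnatr_eq0.
  have [/an a3|[c3 /an a2]] := charge_coef_neq k5 l5 kl; [left|right; split].
  - by rewrite /b3 oppr_eq0; apply: mulf_neq0; [exact: mulf_neq0|rewrite invr_eq0].
  - by rewrite /b3 /a c3 subrr !mul0r oppr0.
  - by rewrite /b2; apply: mulf_neq0; [exact: mulf_neq0|rewrite invr_eq0].
have [m mP] := period_combination_neq0 (a 0%N) b1 B bn.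
exists (Num.min r (expR (- m))); first by rewrite lt_min r0 expR_gt0.
move=> lg x /andP[x0]; rewrite lt_min => /andP[xr xm] lgx.
have [g0 [g1 [g2 [g3 [g0l [h0 h1 h2 h3] [w0 w1 w2 w3]]]]]] := periods x xr lg lgx.
(* |x| is the exponential of Re (lg x), so |x| < e^-m means - Re (lg x) > m for any branch. *)
have Lm : m < cabs (lg x).
  move: xm; rewrite -{1}lgx cabs_expC ltr_expR ltrNr => /lt_le_trans; apply.
  by apply: le_trans (ler_Re_cabs _); rewrite -normrN ler_norm.
rewrite -subr_eq0; apply: contraNneq (mP _ _ _ _ _ Lm g0l h0 h1 h2 h3) => e.
apply/eqP; rewrite -{}e /charge opprD addrACA subrr addr0 -sumrB.
rewrite !big_ord_recl big_ord0 /PiB !mxE /= w0 w1 w2 w3 -/T /b1 /b2 /b3 /a !intrB.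
have f2 : 2`! = 2%N by [].
have f3 : 3`! = 6%N by [].
by rewrite /bump /= !(addn0, add1n) f2 f3; field.
Qed.

End Main.

(** Charges depend only on dimension vectors, hence on isomorphism classes, and those of the simple
    objects only on the coordinate sum modulo 5; every residue occurs. *)
Lemma stable_chargesE (R : realType) (U : set R[i]) (lg : R[i] -> R[i])
    (P : R[i] -> R -> rep R[i] -> Prop) :
  U !=set0 ->
  (forall x, U x -> forall E : rep R[i],
     stable (P x) E <-> exists s, iso E (simple_rep R[i] s)) ->
  stable_charges lg U P = [set patch (fun=> 0) U (charge lg k) | k in `I_5].
Proof.
move=> [x0 Ux0] sP; apply/seteqP; split=> f /=.
  (* The vertex found at the single point [x0] serves on all of [U], since the isomorphism does not
     involve x. *)
  move=> [E /(_ x0 Ux0)/(sP x0 Ux0)[s Es] <-].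
  exists ((\sum_i s i) %% 5)%N; first by rewrite /= ltn_mod.
  congr (patch _ _ _); apply/funext => x.
  by rewrite (Z'_iso lg x Es) Z'_simple_rep Z_simpleE.
move=> [k /= k5 <-]; have [s sk] := sum_vertex k5.
exists (simple_rep R[i] s).
  by move=> x Ux; apply/(sP x Ux); exists s; exact: iso_refl.
congr (patch _ _ _); apply/funext => x.
by rewrite Z'_simple_rep Z_simpleE sk modn_small.
Qed.

Theorem corollary1p5 (R : realType) :
  exists2 r : R, 0 < r &
  forall (U : set R[i]) (lg : R[i] -> R[i]),
    open U -> closure U 0 ->
    U `<=` [set x | 0 < `|x| < r%:C] ->
    {within U, continuous lg} ->
    (forall x, U x -> expC (lg x) = x) ->
  forall P : R[i] -> R -> rep R[i] -> Prop,
    (forall x, U x -> stability_condition (Z' lg x) (P x)) ->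
    (forall x, U x -> forall E : rep R[i],
       stable (P x) E <-> exists s, iso E (simple_rep R[i] s)) ->
  forall x, U x ->
    w lg x 0 != 0 /\ charge_sum lg U P x / w lg x 0 = mirror_map lg x.
Proof.
have [r [B [r0 periods]]] := period_expansion R.
exists r => // U lg _ U0 Ur _ lgE P _ sP x Ux.
have Uxr y : U y -> 0 < cabs y < r.
  by move=> /Ur /=; rewrite normr_gt0 -cabs_gt0 normCE ltcR.
split.
  have /andP[_ xr] := Uxr x Ux.
  have [g0 [g1 [g2 [g3 [g0l _ [-> _ _ _]]]]]] := periods x xr lg (lgE x Ux).
  by rewrite -cabs_gt0; lra.
(* Injectivity turns the sum over a set of functions into a sum over five indices. The separating
   radius may depend on the pair and be smaller than [r]: the closure hypothesis provides a point of
   [U] within it. *)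
have inj : set_inj `I_5 (fun k => patch (fun=> 0) U (charge lg k)).
  move=> k l; rewrite !inE /= => k5 l5 kl; apply: contrapT => /eqP nkl.
  have [e e0 eP] := charge_inj R k5 l5 nkl.
  have [y [Uy ye]] : exists y, U y /\ cabs y < e.
    have eC : 0 < e%:C by rewrite ltcE /= eqxx.
    have [y [Uy ye]] := U0 _ (nbhs0_lt eC); exists y; split=> //.
    by rewrite -ltcR -normCE.
  have /andP[y0 _] := Uxr y Uy.
  have := eP lg y _ (lgE y Uy); rewrite y0 ye => /(_ isT)/eqP; apply.
  by have := congr1 (fun f => f y) kl; rewrite /= !patchT ?inE.
rewrite /charge_sum (stable_chargesE lg (ex_intro _ x Ux) sP) fsbig_image//.
rewrite -(fsbig_ord _ 5 (fun k => patch (fun=> 0) U (charge lg k) x)).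
under eq_bigr do rewrite patchT ?inE//.
by rewrite sum_charge /mirror_map {3}/component mxE inordK.
Qed.
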